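(* Let $k_3,k_5>0$ and $k>0$, and consider on $\mathbb{R}^3_+=\{(x,y,z):x,y,z\ge 0\}$ the system $$x'=kx-xy,\qquad y'=k_3(z-y),\qquad z'=k_5(x-z).$$ Then the system is uniformly persistent, i.e., there exists $\eta>0$ such that for every solution $(x(t),y(t),z(t))$ in $\mathbb{R}^3_+$, $$\min\{x(0),y(0),z(0)\}>0\ \Longrightarrow\ \liminf_{t\to\infty}\min\{x(t),y(t),z(t)\}>\eta.$$ Moreover, let $S=\{(x,y,z)\in\mathbb{R}^3_+:x=0\}$ and let $A$ be the compact attractor of bounded sets, i.e. the non-empty compact invariant set in $\mathbb{R}^3_+$ that attracts all bounded subsets of $\mathbb{R}^3_+$. Then $A$ is the disjoint union $A=\{0\}\cup C\cup A_1$, where: \begin{enumerate} \item[(i)] $\{0\}$ attracts all bounded subsets of $S$. \item[(ii)] $A_1$ is a compact invariant subset of the interior of $\mathbb{R}^3_+$ that attracts all compact subsets of $\mathbb{R}^3_+$ that do not intersect $S$. \item[(iii)] $C$ is the one-dimensional unstable manifold of $\{0\}$ in $\mathbb{R}^3_+$ (with the point $0$ itself removed), which connects $0$ to $A_1$. \end{enumerate}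
   Context: Let $\phi(t,p)$, $t\ge0$, denote the solution of the system starting at $p\in\mathbb{R}^3_+$ at $t=0$. A set $K$ is invariant if $\phi(t,K)=K$ for all $t\ge 0$. A set $K$ attracts a set $B$ if $\sup_{p\in B}\operatorname{dist}(\phi(t,p),K)\to 0$ as $t\to\infty$. The set $A$ exists and is unique. For $k>0$ the origin $0$ is a hyperbolic equilibrium whose stable manifold in $\mathbb{R}^3_+$ is $S$ and whose unstable manifold is one-dimensional. That $C$ connects $0$ to $A_1$ means that through each point of $C$ there is a solution defined for all $t\in\mathbb{R}$, lying in $C$, which tends to $0$ as $t\to-\infty$ and whose distance to $A_1$ tends to $0$ as $t\to\infty$. *)

(* Defs.v *)
From mathcomp Require Import all_boot all_order all_algebra.
From mathcomp Require Import all_classical all_reals all_analysis.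
Set Implicit Arguments.
Unset Strict Implicit.
Unset Printing Implicit Defensive.
Import Order.TTheory GRing.Theory Num.Theory.
Import numFieldNormedType.Exports.

Local Open Scope classical_set_scope.
Local Open Scope ring_scope.

Notation R3 R := (R * R * R)%type.

Section System.
Context {R : realType}.
Implicit Types (p : R3 R) (K B C M : set (R3 R)).

Definition xc p : R := p.1.1.
Definition yc p : R := p.1.2.
Definition zc p : R := p.2.

Definition orthant : set (R3 R) := [set p | [/\ 0 <= xc p, 0 <= yc p & 0 <= zc p]].

Definition faceS : set (R3 R) := [set p | orthant p /\ xc p = 0].

Definition mincoord p : R := Num.min (xc p) (Num.min (yc p) (zc p)).

(* At an end point of the interval I belonging to I, only continuity is
   required; together with the equations inside I this is equivalent to the
   equations holding there with one-sided derivatives. *)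
Definition solution_on (k k3 k5 : R) (I : set R) (u : R -> R3 R) : Prop :=
  [/\ {within I, continuous u},
      forall t, I t -> orthant (u t) &
      forall t, I° t ->
        [/\ is_derive t 1 (xc \o u) (k * xc (u t) - xc (u t) * yc (u t)),
            is_derive t 1 (yc \o u) (k3 * (zc (u t) - yc (u t))) &
            is_derive t 1 (zc \o u) (k5 * (xc (u t) - zc (u t)))]].

Definition solution_semiflow (k k3 k5 : R) (phi : R -> R3 R -> R3 R) : Prop :=
  forall p, orthant p ->
    phi 0 p = p /\ solution_on k k3 k5 `[0, +oo[ (phi ^~ p).

Definition uniformly_persistent (k k3 k5 : R) : Prop :=
  exists2 eta : R, 0 < eta &
    forall u, solution_on k k3 k5 `[0, +oo[ u ->
      0 < mincoord (u 0) ->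
      (eta%:E < limf_einf (fun t => (mincoord (u t))%:E) (+oo%R : set_system R))%E.

Definition flow_invariant (phi : R -> R3 R -> R3 R) K : Prop :=
  forall t, 0 <= t -> phi t @` K = K.

(* The supremum is taken in [0, +oo], so that it is 0 when B is empty. *)
Definition sup_dist K B : \bar R := ereal_sup (0%E |` [set edist_inf K p | p in B]).

Definition attracts (phi : R -> R3 R -> R3 R) K B : Prop :=
  sup_dist K (phi t @` B) @[t --> +oo%R] --> 0%E.

Definition compact_attractor (phi : R -> R3 R -> R3 R) K : Prop :=
  [/\ K !=set0, compact K, K `<=` orthant, flow_invariant phi K &
      forall B, B `<=` orthant -> bounded_set B -> attracts phi K B].

Definition unstable_manifold0 (k k3 k5 : R) : set (R3 R) :=
  [set p | exists u, [/\ solution_on k k3 k5 setT u, u 0 = p &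
                         u t @[t --> -oo%R] --> (0 : R3 R)]].

(* M is a nonempty embedded one-dimensional C^1 submanifold of R^3: near each of
   its points it is the image of ]-1, 1[ under a regular C^1 parametrization g
   that is a homeomorphism onto its image, with inverse h. *)
Definition one_dimensional M : Prop :=
  M !=set0 /\
  forall p, M p -> exists (U : set (R3 R)) (g : R -> R3 R) (h : R3 R -> R),
    [/\ open U, U p, g @` `]-1, 1[ = M `&` U,
        {within M `&` U, continuous h} &
        forall s, s \in `]-1, 1[ ->
          [/\ h (g s) = s, derivable g s 1, {for s, continuous g^`()%classic} &
              g^`()%classic s != 0]].

Definition connects0 (k k3 k5 : R) C K : Prop :=
  forall p, C p -> exists u,
    [/\ solution_on k k3 k5 setT u, u 0 = p, forall t, C (u t),
        u t @[t --> -oo%R] --> (0 : R3 R) &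
        edist_inf K (u t) @[t --> +oo%R] --> 0%E].

End System.

(* Main.v *)
Require Import Defs.
From mathcomp Require Import all_boot all_order all_algebra.
From mathcomp Require Import all_classical all_reals all_analysis.
From mathcomp Require Import ring lra.
Set Implicit Arguments.
Unset Strict Implicit.
Unset Printing Implicit Defensive.
Import Order.TTheory GRing.Theory Num.Theory.
Import numFieldNormedType.Exports.

Local Open Scope classical_set_scope.
Local Open Scope ring_scope.

(** The whole proof rests on linear differential inequalities: if f' >= r (c - f),
then f - c stays above its initial value times exp (- r t). All estimates are
arranged to have this form.

Dissipativity. The differences z - alpha x and y - beta x, for suitable positive
alpha and beta, are asymptotically bounded below, so y >= beta x - k after some
time, hence x' <= x (2 k - beta x) and x is eventually bounded by a constant of
the parameters; y and z follow. The time needed depends only on a bound for the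
initial data (ultimate_bound).

Persistence. The potential w = exp (y / k3 + z / k5) / x satisfies
w' = - (k - x) w = - k w + exp (y / k3 + z / k5), because the logarithmic
derivatives k - y, z - y and x - z telescope. Below the ultimate bound this gives
w' <= k (w0 - w) for a constant w0 (potential_decay). Forward in time w is
therefore eventually at most 2 w0, and x >= 1 / w stays away from 0
(eventually_persistent, uniform_persistence). Backward in time, along a complete
orbit in the attractor, w either never exceeds w0 or grows exponentially, and then
the orbit tends to the origin (past_to_zero). This dichotomy is the decomposition
of A: the first kind of orbit makes up the interior attractor A1, the second kind
the unstable manifold, and a point of A with x = 0 must be 0 (attractor_face).
That A1 attracts compact sets away from the face follows from an omega-limit
argument in which injectivity of the semiflow replaces the selection of
subsequences (interior_attractor_attracts).

The unstable manifold. A point of A with 0 < x < 1 / (2 w0) exists because the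
image of a segment of the x-axis under the semiflow joins the origin to the region
where x >= 1 / (2 w0), and ends up near A (unstable_branch_nonempty). Such a point
does not lie on an orbit of the first kind, so it lies on the unstable manifold.
Two orbits that leave the origin are time shifts of each other: near 0 the
quadratic form (dy)^2 / k3 + (dz)^2 / k5 - (4 / k) (dx)^2 of their difference is
nonincreasing and tends to 0 at minus infinity, so it is nonpositive; two such
orbits with the same x at one time therefore coincide (cone_nincr,
unstable_unique). The unstable manifold without 0 is thus a single orbit. It is an
embedded curve because the time at which the orbit passes through a point depends
continuously on the point (clock_continuous): far back in time w is strictly
decreasing along the orbit, and backward Lipschitz dependence on A transports
this to every time. *)

(** * Linear differential inequalities *)

Section Comparison.
Context {R : realType}.
Implicit Types (f df : R -> R) (a b c r : R).

Lemma itvcc a b t : `[a, b]%classic t <-> a <= t <= b.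
Proof. by rewrite /= in_itv. Qed.

(** The function (f - c) exp (r t) is nondecreasing. The sign of r is free: negative
values give exponential growth and backward estimates. *)
Lemma comparison_lower f df a b c r : a <= b ->
  {within `[a, b], continuous f} ->
  (forall t, a < t < b -> is_derive t 1 f (df t)) ->
  (forall t, a < t < b -> r * (c - f t) <= df t) ->
  (f a - c) * expR (- (r * (b - a))) <= f b - c.
Proof.
move=> ab cf fE le.
pose g t := (f t - c) * expR (r * t).
have gE t : a < t < b -> is_derive t 1 g ((df t + r * (f t - c)) * expR (r * t)).
  move=> tab; have /= ? := fE _ tab.
  apply: is_derive_eq; rewrite /GRing.scale /=; ring.
have cg : {within `[a, b], continuous g}.
  have ce : continuous (fun t : R => expR (r * t)).
    move=> t; apply: continuous_comp; last exact: continuous_expR.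
    by apply: cvgM; [exact: cvg_cst|exact: cvg_id].
  move=> t; apply: cvgM.
    by apply: cvgB; [exact: cf|exact: cvg_cst].
  by apply: continuous_subspaceT.
have gab : g a <= g b.
  apply: (@ger0_derive1_le_cc _ g a b) => //.
  - by move=> t; rewrite in_itv /= => /gE [].
  - move=> t; rewrite in_itv /= => tab; have [_ gt] := gE _ tab.
    rewrite derive1E gt mulr_ge0 ?expR_ge0 //.
    by have := le _ tab; lra.
  - by rewrite in_itv /= lexx.
  - by rewrite in_itv /= lexx ab.
rewrite mulrBr opprB expRD expRN mulrA ler_pdivrMr ?expR_gt0 //.
Qed.

Lemma comparison_upper f df a b c r : a <= b ->
  {within `[a, b], continuous f} ->
  (forall t, a < t < b -> is_derive t 1 f (df t)) ->
  (forall t, a < t < b -> df t <= r * (c - f t)) ->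
  f b - c <= (f a - c) * expR (- (r * (b - a))).
Proof.
move=> ab cf fE le.
have := @comparison_lower (fun t => - f t) (fun t => - df t) a b (- c) r ab.
rewrite -lerN2 -mulNr !opprB ![- _ - - _]addrC !opprK; apply.
- by move=> t; apply: cvgN; exact: cf.
- by move=> t /fE ?; apply: is_deriveN.
- by move=> t /le; lra.
Qed.

Lemma expR_decay (K e r : R) : 0 < r -> 0 < e ->
  exists2 T : R, 0 <= T & forall t, T <= t -> K * expR (- (r * t)) <= e.
Proof.
move=> r0 e0; exists (`|K| / (e * r)).
  by rewrite divr_ge0 // mulr_ge0 // ltW.
move=> t; rewrite ler_pdivrMr ?mulr_gt0 // => Kt.
rewrite expRN ler_pdivrMr ?expR_gt0 //.
apply: le_trans (ler_norm _) _; apply: le_trans Kt _.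
rewrite mulrC -mulrA ler_wpM2l ?(ltW e0) //.
by apply: le_trans (expR_ge1Dx _); rewrite lerDr.
Qed.

(** The form in which upper comparison bounds are used: T depends on the bound K for
the initial value, not on the solution. *)
Lemma decay_to (K c r e : R) : 0 < r -> 0 < e ->
  exists2 T : R, 0 <= T & forall A B s : R,
    A <= K -> B - c <= (A - c) * expR (- (r * s)) -> T <= s -> B <= c + e.
Proof.
move=> r0 e0; have [T T0 HT] := expR_decay (K - c) r0 e0; exists T => // A B s AK H Ts.
rewrite addrC -lerBlDr; apply: le_trans H _; apply: le_trans (HT _ Ts).
by rewrite ler_wpM2r ?expR_ge0 // lerD2r.
Qed.

End Comparison.

(** * Solutions on an interval *)

Section System.
Context {R : realType} {k k3 k5 : R}.
Context (hk : 0 < k) (hk3 : 0 < k3) (hk5 : 0 < k5).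
Implicit Types (p q : R3 R) (u v : R -> R3 R) (a b c r t : R).

Local Notation sol a b u := (solution_on k k3 k5 `[a, b] u).

Lemma solution_on_sub (I J : set R) u : I `<=` J ->
  solution_on k k3 k5 J u -> solution_on k k3 k5 I u.
Proof.
move=> IJ [cu ou du]; split.
- exact: continuous_subspaceW cu.
- by move=> t /IJ /ou.
- by move=> t It; apply: du; apply: (interiorS IJ).
Qed.

(** Differential inequalities are needed for the coordinates and for z - alpha x and
y - beta x; all of them are linear forms in the state. *)
Definition lin (m n l : R) p : R := m * xc p + n * yc p + l * zc p.

Definition vfield p : R3 R :=
  (k * xc p - xc p * yc p, k3 * (zc p - yc p), k5 * (xc p - zc p)).

Lemma xc_continuous : continuous (@xc R).
Proof. by move=> p; apply: continuous_comp; apply: cvg_fst. Qed.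

Lemma yc_continuous : continuous (@yc R).
Proof. by move=> p; apply: continuous_comp; [apply: cvg_fst|apply: cvg_snd]. Qed.

Lemma zc_continuous : continuous (@zc R).
Proof. by move=> p; apply: cvg_snd. Qed.

Lemma lin_continuous m n l : continuous (lin m n l).
Proof.
move=> p; apply: cvgD; [apply: cvgD|]; apply: cvgM;
  try exact: cvg_cst.
- exact: xc_continuous.
- exact: yc_continuous.
- exact: zc_continuous.
Qed.

Lemma within_comp (I : set R) (F : R3 R -> R) u :
  {within I, continuous u} -> (forall t, I t -> {for u t, continuous F}) ->
  {within I, continuous (F \o u)}.
Proof.
move=> cu cF; rewrite continuous_subspace_in => t; rewrite inE => It.
by apply: (@continuous_comp (subspace I) _ _ u F t); [exact: cu|exact: cF].
Qed.

Lemma sol_derive a b u t : sol a b u -> a < t < b ->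
  [/\ is_derive t 1 (xc \o u) (xc (vfield (u t))),
      is_derive t 1 (yc \o u) (yc (vfield (u t))) &
      is_derive t 1 (zc \o u) (zc (vfield (u t)))].
Proof. by move=> [_ _ du] tab; apply: du; rewrite interior_itv /= in_itv. Qed.

Lemma sol_orthant a b u t : sol a b u -> a <= t <= b -> orthant (u t).
Proof. by move=> [_ + _] tab; apply; apply/itvcc. Qed.

Lemma sol_lin_derive a b u m n l t : sol a b u -> a < t < b ->
  is_derive t 1 (lin m n l \o u) (lin m n l (vfield (u t))).
Proof.
move=> su tab; have [dx dy dz] := sol_derive su tab.
have -> : lin m n l \o u =
  m \*: (xc \o u) + n \*: (yc \o u) + l \*: (zc \o u) by [].
exact: is_derive_eq.
Qed.

Lemma sol_lin_lower a b u m n l c r : a <= b -> sol a b u ->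
  (forall t, a < t < b -> orthant (u t) ->
    r * (c - lin m n l (u t)) <= lin m n l (vfield (u t))) ->
  (lin m n l (u a) - c) * expR (- (r * (b - a))) <= lin m n l (u b) - c.
Proof.
move=> ab su le.
apply: (comparison_lower (f := lin m n l \o u)
  (df := fun t => lin m n l (vfield (u t))) ab).
- by apply: within_comp => [|t _]; [case: su|exact: lin_continuous].
- by move=> t tab; exact: sol_lin_derive su tab.
- move=> t /andP[at_ tb]; apply: le; first by rewrite at_.
  by apply: sol_orthant su _; rewrite !ltW.
Qed.

Lemma sol_lin_upper a b u m n l c r : a <= b -> sol a b u ->
  (forall t, a < t < b -> orthant (u t) ->
    lin m n l (vfield (u t)) <= r * (c - lin m n l (u t))) ->
  lin m n l (u b) - c <= (lin m n l (u a) - c) * expR (- (r * (b - a))).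
Proof.
move=> ab su le.
apply: (comparison_upper (f := lin m n l \o u)
  (df := fun t => lin m n l (vfield (u t))) ab).
- by apply: within_comp => [|t _]; [case: su|exact: lin_continuous].
- by move=> t tab; exact: sol_lin_derive su tab.
- move=> t /andP[at_ tb]; apply: le; first by rewrite at_.
  by apply: sol_orthant su _; rewrite !ltW.
Qed.

Lemma itv_oo_cc a b t : a < t -> t < b -> a <= t <= b.
Proof. by move=> /ltW -> /ltW ->. Qed.

Lemma sol_sub a b a' b' u : a <= a' -> b' <= b -> sol a b u -> sol a' b' u.
Proof.
move=> aa bb; apply: solution_on_sub => t /itvcc /andP[a't tb'].
by apply/itvcc; rewrite (le_trans aa a't) (le_trans tb' bb).
Qed.

Lemma lin_vfieldE m n l p : lin m n l (vfield p) =
  m * (k * xc p - xc p * yc p) + n * (k3 * (zc p - yc p))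
  + l * (k5 * (xc p - zc p)).
Proof. by []. Qed.

Lemma lin_xE p : lin 1 0 0 p = xc p. Proof. by rewrite /lin; ring. Qed.
Lemma lin_yE p : lin 0 1 0 p = yc p. Proof. by rewrite /lin; ring. Qed.
Lemma lin_zE p : lin 0 0 1 p = zc p. Proof. by rewrite /lin; ring. Qed.

(** * Bounds for the coordinates *)

(** As long as y <= Y, the growth rate k - y of x is at least k - Y. *)
Lemma sol_x_lower a b u Y : a <= b -> sol a b u ->
  (forall t, a <= t <= b -> yc (u t) <= Y) ->
  xc (u a) * expR ((k - Y) * (b - a)) <= xc (u b).
Proof.
move=> ab su yY.
have := @sol_lin_lower a b u 1 0 0 0 (Y - k) ab su.
have -> : - ((Y - k) * (b - a)) = (k - Y) * (b - a) by ring.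
rewrite !lin_xE !subr0; apply => t /andP[at_ tb] [x0 _ _].
have ty := yY t (itv_oo_cc at_ tb).
rewrite lin_vfieldE /lin; nra.
Qed.

Lemma sol_x_upper a b u : a <= b -> sol a b u ->
  xc (u b) <= xc (u a) * expR (k * (b - a)).
Proof.
move=> ab su.
have := @sol_lin_upper a b u 1 0 0 0 (- k) ab su.
rewrite mulNr opprK !lin_xE !subr0; apply => t _ [x0 y0 _].
rewrite lin_vfieldE /lin; nra.
Qed.

Lemma sol_z_upper a b u X : a <= b -> sol a b u ->
  (forall t, a <= t <= b -> xc (u t) <= X) ->
  zc (u b) - X <= (zc (u a) - X) * expR (- (k5 * (b - a))).
Proof.
move=> ab su xX.
have := @sol_lin_upper a b u 0 0 1 X k5 ab su.
rewrite !lin_zE; apply => t /andP[at_ tb] _.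
have tx := xX t (itv_oo_cc at_ tb).
by have := ler_wpM2l (ltW hk5) tx; rewrite lin_vfieldE /lin; lra.
Qed.

Lemma sol_y_upper a b u Z : a <= b -> sol a b u ->
  (forall t, a <= t <= b -> zc (u t) <= Z) ->
  yc (u b) - Z <= (yc (u a) - Z) * expR (- (k3 * (b - a))).
Proof.
move=> ab su zZ.
have := @sol_lin_upper a b u 0 1 0 Z k3 ab su.
rewrite !lin_yE; apply => t /andP[at_ tb] _.
have tz := zZ t (itv_oo_cc at_ tb).
by have := ler_wpM2l (ltW hk3) tz; rewrite lin_vfieldE /lin; lra.
Qed.

Lemma sol_z_lower a b u X : a <= b -> sol a b u ->
  (forall t, a <= t <= b -> X <= xc (u t)) ->
  (zc (u a) - X) * expR (- (k5 * (b - a))) <= zc (u b) - X.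
Proof.
move=> ab su xX.
have := @sol_lin_lower a b u 0 0 1 X k5 ab su.
rewrite !lin_zE; apply => t /andP[at_ tb] _.
have tx := xX t (itv_oo_cc at_ tb).
by have := ler_wpM2l (ltW hk5) tx; rewrite lin_vfieldE /lin; lra.
Qed.

Lemma sol_y_lower a b u Z : a <= b -> sol a b u ->
  (forall t, a <= t <= b -> Z <= zc (u t)) ->
  (yc (u a) - Z) * expR (- (k3 * (b - a))) <= yc (u b) - Z.
Proof.
move=> ab su zZ.
have := @sol_lin_lower a b u 0 1 0 Z k3 ab su.
rewrite !lin_yE; apply => t /andP[at_ tb] _.
have tz := zZ t (itv_oo_cc at_ tb).
by have := ler_wpM2l (ltW hk3) tz; rewrite lin_vfieldE /lin; lra.
Qed.

Definition below (X : R) : set (R3 R) :=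
  [set p | [/\ xc p <= X, yc p <= X & zc p <= X]].

(** Only x can grow, at most at rate k; y and z relax towards z and x, so they stay
below any bound that they share with x. *)
Lemma sol_below a b u X : a <= b -> sol a b u -> 0 <= X -> below X (u a) ->
  below (X * expR (k * (b - a))) (u b).
Proof.
move=> ab su X0 [xX yX zX].
have e1 t : a <= t -> 1 <= expR (k * (t - a)).
  by move=> at_; rewrite -expR0 ler_expR mulr_ge0 ?subr_ge0 // ltW.
have hX t : a <= t <= b -> xc (u t) <= X * expR (k * (b - a)).
  move=> /andP[at_ tb]; apply: le_trans (sol_x_upper at_ (sol_sub (lexx _) tb su)) _.
  by apply: ler_pM; rewrite ?expR_ge0 ?ler_expR //;
    [have [] := sol_orthant su (t := a);
      rewrite ?lexx|rewrite ler_wpM2l ?lerD2r // ltW].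
have XX : X <= X * expR (k * (b - a)) by rewrite ler_peMr // e1.
have decay (w s : R) : s <= X -> (s - X * expR (k * (b - a))) * expR w <= 0.
  by move=> sX; rewrite mulr_le0_ge0 ?expR_ge0 // subr_le0 (le_trans sX).
have hZ t : a <= t <= b -> zc (u t) <= X * expR (k * (b - a)).
  move=> /andP[at_ tb]; rewrite -subr_le0.
  apply: le_trans (sol_z_upper at_ (sol_sub (lexx _) tb su) _) (decay _ _ zX).
  by move=> s /andP[as_ st]; apply: hX; rewrite as_ (le_trans st).
split; [by apply: hX; rewrite ab lexx| |by apply: hZ; rewrite ab lexx].
rewrite -subr_le0.
by apply: le_trans (sol_y_upper ab su hZ) (decay _ _ yX).
Qed.

(** With alpha = k5 / (k5 + k), the derivative of z - alpha x is
- k5 (z - alpha x) + alpha x y: alpha is the ratio at which z follows an x that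
grows at its maximal rate k. *)
Lemma sol_z_ratio a b u : a <= b -> sol a b u ->
  (zc (u a) - k5 / (k5 + k) * xc (u a)) * expR (- (k5 * (b - a)))
    <= zc (u b) - k5 / (k5 + k) * xc (u b).
Proof.
move=> ab su; set al := k5 / (k5 + k).
have alE : al * (k5 + k) = k5 by rewrite /al divfK ?lt0r_neq0 ?addr_gt0.
have al0 : 0 < al by rewrite /al divr_gt0 ?addr_gt0.
clearbody al.
have := @sol_lin_lower a b u (- al) 0 1 0 k5 ab su.
have E p : lin (- al) 0 1 p - 0 = zc p - al * xc p by rewrite /lin; ring.
rewrite !E; apply => t _ [x0 y0 _].
have axy : 0 <= al * xc (u t) * yc (u t) by rewrite !mulr_ge0 // ltW.
have -> : lin (- al) 0 1 (vfield (u t)) = k5 * (xc (u t) - zc (u t))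
   - al * k * xc (u t) + al * xc (u t) * yc (u t).
  by rewrite lin_vfieldE; ring.
have -> : al * k = k5 - al * k5 by rewrite -{1}alE; ring.
rewrite /lin; lra.
Qed.

(** The same for y, which follows z as z follows x; beta solves
beta (k3 + k) = k3 alpha, and d is the error left by sol_z_ratio. *)
Lemma sol_y_ratio a b u d (be := k3 * (k5 / (k5 + k)) / (k3 + k)) : a <= b ->
  sol a b u ->
  (forall t, a <= t <= b -> - d <= zc (u t) - k5 / (k5 + k) * xc (u t)) ->
  (yc (u a) - be * xc (u a) + d) * expR (- (k3 * (b - a)))
    <= yc (u b) - be * xc (u b) + d.
Proof.
move=> ab su; rewrite {}/be; set al := k5 / (k5 + k) => hz; set be := _ / (k3 + k).
have al0 : 0 < al by rewrite /al divr_gt0 ?addr_gt0.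

have beE : be * (k3 + k) = k3 * al.
  by rewrite /be divfK ?lt0r_neq0 ?addr_gt0.
have be0 : 0 < be.
  by apply: divr_gt0; [exact: mulr_gt0|exact: addr_gt0].
clearbody be al.
have := @sol_lin_lower a b u (- be) 1 0 (- d) k3 ab su.
have E p : lin (- be) 1 0 p - - d = yc p - be * xc p + d by rewrite /lin; ring.
rewrite !E; apply => t /andP[at_ tb] [x0 y0 _].
have tz := hz t (itv_oo_cc at_ tb).
have axy : 0 <= be * xc (u t) * yc (u t) by rewrite !mulr_ge0 // ltW.
have -> : lin (- be) 1 0 (vfield (u t)) = k3 * (zc (u t) - yc (u t))
   - be * k * xc (u t) + be * xc (u t) * yc (u t).
  by rewrite lin_vfieldE; ring.
have -> : be * k = k3 * al - be * k3 by rewrite -beE; ring.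
have := ler_wpM2l (ltW hk3) tz.
rewrite /lin; lra.
Qed.


(** * Dissipativity *)

(** Once y >= beta x - k, the derivative of x is at most k (9 k / (4 beta) - x); the
summand 3 allows an error of 1 for each of x, z and y in turn. *)
Definition Mbound : R := 9 * k / (4 * (k3 * (k5 / (k5 + k)) / (k3 + k))) + 3.

(** Five stages, each lasting a time that depends only on X: lower bounds for
z - alpha x and then y - beta x, then upper bounds for x, z and y. *)
Lemma ultimate_bound X : exists2 T : R, 0 <= T &
  forall a b u, a + T <= b -> sol a b u -> below X (u a) -> below Mbound (u b).
Proof.
rewrite /Mbound; set al := k5 / (k5 + k); set be := k3 * al / (k3 + k).
have al0 : 0 < al by apply: divr_gt0 => //; exact: addr_gt0.
have be0 : 0 < be.
  by apply: divr_gt0; [exact: mulr_gt0|exact: addr_gt0].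
pose c : R := 9 * k / (4 * be).
have cE : 4 * be * c = 9 * k by rewrite mulrC divfK // mulf_neq0 // lt0r_neq0.
have c0 : 0 < c by rewrite divr_gt0 // mulr_gt0.
rewrite -/c; have -> : c + 3 = c + 1 + 1 + 1 by lra.
(* X may be negative, and the a priori bounds start from a nonnegative one. *)
pose X1 : R := `|X|; have X10 : 0 <= X1 by exact: normr_ge0.
have k2 : 0 < k / 2 by rewrite divr_gt0.
have [T1 T10 H1] := expR_decay (al * X1) hk5 k2.
have [T2 T20 H2] := expR_decay (be * (X1 * expR (k * T1))) hk3 k2.
have [T3 T30 H3] := decay_to (X1 * expR (k * (T1 + T2))) c hk ltr01.
have [T4 T40 H4] := decay_to (X1 * expR (k * (T1 + T2 + T3))) (c + 1) hk5 ltr01.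
have [T5 T50 H5] := decay_to (X1 * expR (k * (T1 + T2 + T3 + T4))) (c + 1 + 1) hk3
  ltr01.
exists (T1 + T2 + T3 + T4 + T5); first by rewrite !addr_ge0.
move=> a b u ab su [xX yX zX].
have bX1 : below X1 (u a).
  by split; apply: le_trans (ler_norm X).
have early t : a <= t <= b -> below (X1 * expR (k * (t - a))) (u t).
  move=> /andP[at_ tb]; exact: sol_below (sol_sub (lexx _) tb su) _ _.
have earlyT (T : R) : 0 <= T -> a + T <= b -> below (X1 * expR (k * T)) (u (a + T)).
  move=> T0 Tb; have -> : k * T = k * (a + T - a) by ring.
  by apply: early; rewrite lerDl T0.
have s1 t : a + T1 <= t <= b -> - (k / 2) <= zc (u t) - al * xc (u t).
  move=> /andP[at_ tb]; have at' : a <= t by apply: le_trans at_; rewrite lerDl.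
  apply: le_trans (sol_z_ratio at' (sol_sub (lexx _) tb su)).
  rewrite -/al; apply: le_trans (_ : - (al * X1) * expR (- (k5 * (t - a))) <= _).
    by rewrite mulNr lerN2; apply: H1; rewrite lerBrDl.
  rewrite ler_wpM2r ?expR_ge0 //.
  have : al * xc (u a) <= al * X1.
    by case: bX1 => xX1 _ _; apply: ler_wpM2l => //; exact: ltW.
  have [_ _] : orthant (u a) by apply: sol_orthant su _; rewrite lexx (le_trans at').
  lra.
have s2 t : a + T1 + T2 <= t <= b -> be * xc (u t) - k <= yc (u t).
  move=> /andP[at_ tb]; have at' : a + T1 <= t by apply: le_trans at_; rewrite lerDl.
  have a1b : a <= a + T1 <= b by rewrite lerDl T10 (le_trans at' tb).
  have su1 : sol (a + T1) t u by apply: sol_sub tb su; rewrite lerDl.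
  have := sol_y_ratio at' su1 (d := k / 2).
  rewrite -/al -/be => H.
  have {H}H : (yc (u (a + T1)) - be * xc (u (a + T1)) + k / 2) *
     expR (- (k3 * (t - (a + T1)))) <= yc (u t) - be * xc (u t) + k / 2.
    apply: H => s /andP[as_ st]; apply: s1; by rewrite as_ (le_trans st).
  suff : - (k / 2) <= (yc (u (a + T1)) - be * xc (u (a + T1)) + k / 2) *
     expR (- (k3 * (t - (a + T1)))).
    by move=> H'; have := le_trans H' H; lra.
  apply: le_trans (_ : - (be * (X1 * expR (k * T1))) * expR (- (k3 * (t - (a +
    T1)))) <= _).
    by rewrite mulNr lerN2; apply: H2; rewrite lerBrDl.
  rewrite ler_wpM2r ?expR_ge0 //.
  have [_ y0 _] := sol_orthant su a1b.
  have : be * xc (u (a + T1)) <= be * (X1 * expR (k * T1)).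
    rewrite ler_wpM2l ?(ltW be0) //.
    by have [] := earlyT T1 T10 (proj2 (andP a1b)).
  lra.
have s3 t : a + (T1 + T2) + T3 <= t <= b -> xc (u t) <= c + 1.
  move=> /andP[at_ tb].
  have at' : a + (T1 + T2) <= t by apply: le_trans at_; rewrite lerDl.
  have su1 : sol (a + (T1 + T2)) t u by apply: sol_sub tb su; rewrite lerDl addr_ge0.
  apply: (H3 (xc (u (a + (T1 + T2)))) _ (t - (a + (T1 + T2)))).
  - by have [] := earlyT (T1 + T2) (addr_ge0 T10 T20) (le_trans at' tb).
  - rewrite -!lin_xE; apply: sol_lin_upper su1 _ => // s /andP[as_ st] [x0 _ _].
    have := s2 s; rewrite -addrA (ltW as_) (ltW (lt_le_trans st tb)) => /(_ isT) ys.
    rewrite lin_vfieldE /lin.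
    have h1 : xc (u s) * (be * xc (u s) - k) <= xc (u s) * yc (u s).
      by rewrite ler_wpM2l.
    (* 3 k x - be x^2 is largest at x = 3 k / (2 be), where it equals k c. *)
    suff : 3 * k * xc (u s) - be * xc (u s) ^+ 2 <= k * c by lra.
    rewrite -(ler_pM2l (_ : 0 < 4 * be)); last by rewrite mulr_gt0.
    have -> : 4 * be * (k * c) = 9 * k * k by rewrite -cE; ring.
    rewrite -subr_ge0; have -> : 9 * k * k - 4 * be * (3 * k * xc (u s) - be * xc
      (u s) ^+ 2) = (2 * be * xc (u s) - 3 * k) ^+ 2 by ring.
    exact: sqr_ge0.
  - by rewrite lerBrDl.
have s4 t : a + (T1 + T2 + T3) + T4 <= t <= b -> zc (u t) <= c + 1 + 1.
  move=> /andP[at_ tb].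
  have at' : a + (T1 + T2 + T3) <= t by apply: le_trans at_; rewrite lerDl.
  have su1 : sol (a + (T1 + T2 + T3)) t u by apply: sol_sub tb su;
    rewrite lerDl !addr_ge0.
  apply: (H4 (zc (u (a + (T1 + T2 + T3)))) _ (t - (a + (T1 + T2 + T3)))).
  - by have [] := earlyT (T1 + T2 + T3) (addr_ge0 (addr_ge0 T10 T20) T30) (le_trans
    at' tb).
  - apply: sol_z_upper su1 _ => // s /andP[as_ st]; apply: s3.
    by rewrite (le_trans st tb) andbT -addrA.
  - by rewrite lerBrDl.
have s5 : yc (u b) <= c + 1 + 1 + 1.
  have at' : a + (T1 + T2 + T3 + T4) <= b.
    by apply: le_trans ab; rewrite lerD2l lerDl.
  have su1 : sol (a + (T1 + T2 + T3 + T4)) b u by apply: sol_sub su;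
    rewrite ?lerDl ?addr_ge0.
  apply: (H5 (yc (u (a + (T1 + T2 + T3 + T4)))) _ (b - (a + (T1 + T2 + T3 + T4)))).
  - by have [] := earlyT (T1 + T2 + T3 + T4) (addr_ge0 (addr_ge0 (addr_ge0 T10 T20)
    T30) T40) at'.
  - apply: sol_y_upper su1 _ => // s /andP[as_ st]; apply: s4.
    by rewrite st andbT -addrA.
  - by rewrite lerBrDl; lra.
split=> //.
- apply: le_trans (s3 b _) _; last by lra.
  by rewrite lexx andbT; lra.
- apply: le_trans (s4 b _) _; last by lra.
  by rewrite lexx andbT; lra.
Qed.

(** * The potential and persistence *)

(** Its logarithm is y / k3 + z / k5 - log x, whose derivative
(z - y) + (x - z) - (k - y) is x - k. *)
Definition potential p : R := expR (yc p / k3 + zc p / k5) / xc p.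

Lemma potential_continuous p : 0 < xc p -> {for p, continuous potential}.
Proof.
move=> x0; apply: cvgM; last by apply: cvgV; [rewrite lt0r_neq0|exact: xc_continuous].
apply: (@continuous_comp _ _ _ (fun p => yc p / k3 + zc p / k5) expR);
  last exact: continuous_expR.
apply: cvgD; apply: cvgM; try exact: cvg_cst.
  exact: yc_continuous.
exact: zc_continuous.
Qed.

(** The derivative of the potential is exp (y / k3 + z / k5) - k * potential, and
the exponential is at most k * th below M. *)
Lemma potential_decay a b u M (th := expR (M / k3 + M / k5) / k) : a <= b ->
  sol a b u ->
  (forall t, a <= t <= b -> below M (u t)) -> 0 < xc (u a) ->
  potential (u b) - th <= (potential (u a) - th) * expR (- (k * (b - a))).
Proof.
move=> ab su bM xa.
have x0 t : a <= t <= b -> 0 < xc (u t).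
  move=> /andP[at_ tb].
  apply: lt_le_trans (sol_x_lower at_ (sol_sub (lexx _) tb su) (Y := M) _).
    by rewrite mulr_gt0 ?expR_gt0.
  by move=> s /andP[as_ st]; have [] := bM s _; rewrite ?as_ ?(le_trans st).
apply: (comparison_upper (f := potential \o u)
  (df := fun t => expR (yc (u t) / k3 + zc (u t) / k5) - k * potential (u t)) ab).
- apply: within_comp => [|t /itvcc tab]; first by case: su.
  exact: potential_continuous (x0 t tab).
- move=> t /andP[at_ tb]; have tab : a < t < b by rewrite at_.
  have [dx dy dz] := sol_derive su tab.
  have xt := x0 t (itv_oo_cc at_ tb).
  have dE : is_derive t 1 (expR \o (lin 0 k3^-1 k5^-1 \o u))
     (expR (lin 0 k3^-1 k5^-1 (u t)) * lin 0 k3^-1 k5^-1 (vfield (u t))).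
    apply: is_derive1_comp; exact: sol_lin_derive su tab.
  have dV := is_deriveV (lt0r_neq0 xt) dx.
  have -> : potential \o u = (expR \o (lin 0 k3^-1 k5^-1 \o u)) * (fun s =>
    ((xc \o u) s)^-1).
    apply/funext => s; rewrite /potential -[RHS]/(expR (lin 0 k3^-1 k5^-1 (u s)) *
      _) /lin.
    by rewrite mul0r add0r ![_^-1 * _]mulrC.
  apply: is_derive_eq; rewrite /GRing.scale /= lin_vfieldE mul0r add0r.
  have -> : lin 0 k3^-1 k5^-1 (u t) = yc (u t) / k3 + zc (u t) / k5.
    by rewrite /lin; ring.
  rewrite /potential -[xc (vfield _)]/(k * xc (u t) - xc (u t) * yc (u t)).
  rewrite /GRing.scale /=; field.
  by rewrite !lt0r_neq0.
- move=> t /andP[at_ tb].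
  have [_ yM zM] := bM t (itv_oo_cc at_ tb).
  rewrite mulrBr [k * th]mulrC divfK ?lt0r_neq0 // lerD2r ler_expR lerD //.
    by rewrite ler_pdivrMr // divfK // lt0r_neq0.
  by rewrite ler_pdivrMr // divfK // lt0r_neq0.
Qed.


Definition threshold : R := expR (Mbound / k3 + Mbound / k5) / k.

Lemma threshold_gt0 : 0 < threshold.
Proof. by rewrite divr_gt0 // expR_gt0. Qed.

(** The factor 2 leaves room to reach this set in finite time, since the potential
approaches the threshold only asymptotically. The inequality is multiplied out so
that the set is closed and excludes x = 0. *)
Definition persistent : set (R3 R) :=
  [set p | expR (yc p / k3 + zc p / k5) <= 2 * threshold * xc p].

Lemma persistentP p : persistent p <-> 0 < xc p /\ potential p <= 2 * threshold.
Proof.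
rewrite /persistent /potential /=; split => [H|[x0]]; last by rewrite ler_pdivrMr.
have x0 : 0 < xc p.
  rewrite -(pmulr_rgt0 _ (_ : 0 < 2 * threshold));
    last by rewrite mulr_gt0 // threshold_gt0.
  exact: lt_le_trans (expR_gt0 _) H.
by split=> //; rewrite ler_pdivrMr.
Qed.

Lemma inv_x_le_potential p : orthant p -> 0 < xc p -> (xc p)^-1 <= potential p.
Proof.
move=> [_ y0 z0] x0; rewrite /potential ler_peMl ?invr_ge0 ?(ltW x0) //.
by rewrite -expR0 ler_expR addr_ge0 // divr_ge0 // ltW.
Qed.

Lemma persistent_x_ge p : orthant p -> persistent p -> (2 * threshold)^-1 <= xc p.
Proof.
move=> op /persistentP [x0 wW].
have W0 : 0 < 2 * threshold by apply: mulr_gt0 => //; exact: threshold_gt0.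
rewrite -[leRHS]invrK lef_pV2 ?posrE ?invr_gt0 //.
exact: le_trans (inv_x_le_potential op x0) wW.
Qed.

(** Before the ultimate bound is reached, y is controlled by the initial bound X
alone, so x cannot fall below a positive value depending on X and xi; from then on
the potential decays from a controlled value. *)
Lemma eventually_persistent X xi : 0 < xi -> exists2 T : R, 0 <= T &
  forall a b u, a + T <= b -> sol a b u -> below X (u a) -> xi <= xc (u a) ->
  below Mbound (u b) /\ persistent (u b).
Proof.
move=> xi0; have [T1 T10 H1] := ultimate_bound X.
(* Y bounds y during the time T1 that the solution needs to enter the ultimate
   bound, so xi1 bounds x from below at the end of that time. *)
pose Y : R := `|X| * expR (k * T1).
pose xi1 := xi * expR ((k - Y) * T1).
have xi10 : 0 < xi1 by rewrite mulr_gt0 // expR_gt0.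
have [T2 T20 H2] := decay_to (expR (Mbound / k3 + Mbound / k5) / xi1) threshold hk
  threshold_gt0.
exists (T1 + T2); first exact: addr_ge0.
move=> a b u ab su bX xxi.
have aT : a <= a + T1 by rewrite lerDl.
have Tb : a + T1 <= b by apply: le_trans ab; rewrite lerD2l lerDl.
have ultb t : a + T1 <= t <= b -> below Mbound (u t).
  by move=> /andP[at_ tb]; apply: H1 at_ (sol_sub (lexx _) tb su) bX.
have xT : xi1 <= xc (u (a + T1)).
  apply: le_trans (_ : xc (u a) * expR ((k - Y) * (a + T1 - a)) <= _).
    by rewrite addrAC subrr add0r ler_wpM2r ?expR_ge0.
  apply: sol_x_lower aT (sol_sub (lexx _) Tb su) _ => t /andP[at_ tT].
  have bX' : below `|X| (u a) by case: bX => *; split; apply: le_trans (ler_norm _).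
  have [_ + _] := sol_below at_ (sol_sub (lexx _) (le_trans tT Tb) su) (normr_ge0
    _) bX'.
  move=> /le_trans; apply; rewrite ler_wpM2l // ler_expR ler_wpM2l ?(ltW hk) //.
  by rewrite lerBlDl.
have xT0 : 0 < xc (u (a + T1)) by apply: lt_le_trans xT.
have suT : sol (a + T1) b u by apply: sol_sub su.
have xb0 : 0 < xc (u b).
  apply: lt_le_trans (sol_x_lower Tb suT (Y := Mbound) _).
    by rewrite mulr_gt0 ?expR_gt0.
  by move=> t /ultb [].
split; first by apply: ultb; rewrite Tb lexx.
apply/persistentP; split => //.
have -> : 2 * threshold = threshold + threshold by ring.
apply: (H2 _ _ _ _ (potential_decay Tb suT ultb xT0)); last by lra.
have [_ y1 z1] := ultb (a + T1) (introT andP (conj (lexx _) Tb)).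
rewrite /potential; apply: ler_pM.
- exact: expR_ge0.
- by rewrite invr_ge0 ltW.
- by rewrite ler_expR lerD // ler_pM2r ?invr_gt0.
- by rewrite lef_pV2 ?posrE.
Qed.

(** A lower bound for x is inherited by z within one unit of time, and by y within
one more. *)
Lemma interior_bound (xi : R) : 0 < xi -> exists2 e : R, 0 < e &
  forall a b u, a + 2 <= b -> sol a b u ->
   (forall t, a <= t <= b -> xi <= xc (u t)) -> e <= mincoord (u b).
Proof.
move=> xi0.
pose e1 := xi * (1 - expR (- k5)); pose e2 := e1 * (1 - expR (- k3)).
have f5 : 0 < 1 - expR (- k5) by rewrite subr_gt0 expR_lt1 oppr_lt0.
have f3 : 0 < 1 - expR (- k3) by rewrite subr_gt0 expR_lt1 oppr_lt0.
have e10 : 0 < e1 by rewrite mulr_gt0.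
have e20 : 0 < e2 by rewrite mulr_gt0.
exists e2 => // a b u ab su xu.
have e1b : e1 <= xi by rewrite ler_piMr ?(ltW xi0) // lerBlDr lerDl expR_ge0.
have e2b : e2 <= e1 by rewrite ler_piMr ?(ltW e10) // lerBlDr lerDl expR_ge0.
have aux (w c s r : R) : 0 < r -> 0 <= c -> 0 <= w -> 1 <= s ->
   - (c * expR (- r)) <= (w - c) * expR (- (r * s)).
  move=> r0 c0 wge0 s1; apply: le_trans (_ : - (c * expR (- (r * s))) <= _).
    rewrite lerN2 ler_wpM2l // ler_expR lerN2 ler_peMr // ltW //.
  by rewrite -mulNr ler_wpM2r ?expR_ge0 // lerBrDl subrr.
have zu t : a + 1 <= t <= b -> e1 <= zc (u t).
  move=> /andP[at_ tb]; have at' : a <= t by apply: le_trans at_; rewrite lerDl ler01.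
  have [_ _ z0] : orthant (u a) by apply: sol_orthant su _; rewrite lexx (le_trans at').
  have H : (zc (u a) - xi) * expR (- (k5 * (t - a))) <= zc (u t) - xi.
    apply: sol_z_lower at' (sol_sub (lexx _) tb su) _ => s /andP[as_ st].
    by apply: xu; rewrite as_ (le_trans st).
  have := aux (zc (u a)) xi (t - a) k5 hk5 (ltW xi0) z0 _.
  rewrite lerBrDl => /(_ at_) H'; rewrite /e1; lra.
have yb : e2 <= yc (u b).
  have ab1 : a + 1 <= b by lra.
  have [_ y0 _] : orthant (u (a + 1)) by apply: sol_orthant su _;
    rewrite ab1 lerDl ler01.
  have H : (yc (u (a + 1)) - e1) * expR (- (k3 * (b - (a + 1)))) <= yc (u b) - e1.
    apply: sol_y_lower ab1 (sol_sub _ (lexx _) su) zu; by rewrite lerDl ler01.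
  have := aux (yc (u (a + 1))) e1 (b - (a + 1)) k3 hk3 (ltW e10) y0 _.
  have -> : 1 <= b - (a + 1) by lra.
  move=> /(_ isT) H'; rewrite /e2; lra.
rewrite /mincoord !le_min yb; apply/andP; split.
  by apply: le_trans (le_trans e2b e1b) (xu b _); rewrite lexx andbT; lra.
by apply: le_trans e2b (zu b _); rewrite lexx andbT; lra.
Qed.

(** * Differences of two solutions *)

(** The coefficients may be negative: they are all 1 for the squared distance, and of
mixed sign for cone_form. *)
Definition diff_form (m n l : R) p q : R :=
  m * (xc p - xc q) ^+ 2 + n * (yc p - yc q) ^+ 2 + l * (zc p - zc q) ^+ 2.

(** The derivative of diff_form along a pair of solutions, written in terms of the
differences through x1 y1 - x2 y2 = x1 (y1 - y2) + y2 (x1 - x2). *)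
Definition diff_form' (m n l : R) p q : R :=
  2 * (m * (xc p - xc q) * (k * (xc p - xc q) - xc p * (yc p - yc q) - yc q * (xc p
    - xc q))
   + n * (yc p - yc q) * (k3 * ((zc p - zc q) - (yc p - yc q)))
   + l * (zc p - zc q) * (k5 * ((xc p - xc q) - (zc p - zc q)))).

Lemma diff_form_derive m n l a b u v t : sol a b u -> sol a b v -> a < t < b ->
  is_derive t 1 (fun s => diff_form m n l (u s) (v s)) (diff_form' m n l (u t) (v t)).
Proof.
move=> su sv tab.
have [dx dy dz] := sol_derive su tab; have [dx' dy' dz'] := sol_derive sv tab.
have -> : (fun s => diff_form m n l (u s) (v s)) =
  m \*: (((xc \o u) - (xc \o v)) ^+ 2) + n \*: (((yc \o u) - (yc \o v)) ^+ 2)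
  + l \*: (((zc \o u) - (zc \o v)) ^+ 2).
  by apply/funext => s.
apply: is_derive_eq.
have fx p : xc (vfield p) = k * xc p - xc p * yc p by [].
have fy p : yc (vfield p) = k3 * (zc p - yc p) by [].
have fz p : zc (vfield p) = k5 * (xc p - zc p) by [].
have E (F : R3 R -> R) : (F \o u - (F \o v)) t = F (u t) - F (v t) by [].
by rewrite /diff_form' /GRing.scale /= !E !fx !fy ?fz !expr1; ring.
Qed.

Lemma diff_form_within m n l a b u v : sol a b u -> sol a b v ->
  {within `[a, b], continuous (fun s => diff_form m n l (u s) (v s))}.
Proof.
move=> [cu _ _] [cv _ _].
have c (F : R3 R -> R) : continuous F -> {within `[a, b],
  continuous (fun s => (F (u s) - F (v s)) ^+ 2)}.
  move=> cF t; apply: cvgM; apply: cvgB; apply: within_comp => // s _; exact: cF.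
move=> t; apply: cvgD; [apply: cvgD|]; apply: cvgM; try exact: cvg_cst.
- exact: (c _ xc_continuous).
- exact: (c _ yc_continuous).
- exact: (c _ zc_continuous).
Qed.

Definition gronwall_rate (X : R) : R := 2 * k + 3 * X + 3 * k3 + 3 * k5.

Lemma diff_form'_bound X p q : 0 <= xc p <= X -> 0 <= yc q <= X ->
  `|diff_form' 1 1 1 p q| <= gronwall_rate X * diff_form 1 1 1 p q.
Proof.
move=> /andP[x0 xX] /andP[y0 yX]; rewrite /diff_form' /diff_form /gronwall_rate.
set dx := xc p - xc q; set dy := yc p - yc q; set dz := zc p - zc q.
have sx := sqr_ge0 dx; have sy := sqr_ge0 dy; have sz := sqr_ge0 dz.
have h1 := mulr_ge0 x0 (sqr_ge0 (dx + dy)).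
have h2 := mulr_ge0 x0 (sqr_ge0 (dx - dy)).
have h3 : 0 <= (X - xc p) * (dx ^+ 2 + dy ^+ 2) by rewrite mulr_ge0 ?subr_ge0 ?addr_ge0.
have h4 : 0 <= (X - yc q) * dx ^+ 2 by rewrite mulr_ge0 ?subr_ge0.
have h4' : 0 <= yc q * dx ^+ 2 by rewrite mulr_ge0.
have h5 := mulr_ge0 (ltW hk3) (sqr_ge0 (dy - dz)).
have h6 := mulr_ge0 (ltW hk3) (sqr_ge0 (dy + dz)).
have h7 := mulr_ge0 (ltW hk5) (sqr_ge0 (dx - dz)).
have h8 := mulr_ge0 (ltW hk5) (sqr_ge0 (dx + dz)).
have hx := mulr_ge0 (ltW hk) sx.
have hX0 : 0 <= X := le_trans x0 xX.
have a1 := mulr_ge0 hX0 sx; have a2 := mulr_ge0 hX0 sy; have a3 := mulr_ge0 hX0 sz.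
have b1 := mulr_ge0 (ltW hk) sy; have b2 := mulr_ge0 (ltW hk) sz.
have c1 := mulr_ge0 (ltW hk3) sx; have c2 := mulr_ge0 (ltW hk3) sy; have c3 :=
  mulr_ge0 (ltW hk3) sz.
have d1 := mulr_ge0 (ltW hk5) sx; have d2 := mulr_ge0 (ltW hk5) sy; have d3 :=
  mulr_ge0 (ltW hk5) sz.
rewrite ler_norml; apply/andP; split; lra.
Qed.

(** Both directions are needed: forward for continuity of the semiflow, backward for
its injectivity and for continuity of its inverse. *)
Lemma gronwall a b u v X : a <= b -> sol a b u -> sol a b v ->
  (forall t, a <= t <= b -> below X (u t)) ->
  (forall t, a <= t <= b -> below X (v t)) ->
  diff_form 1 1 1 (u b) (v b) <= diff_form 1 1 1 (u a) (v a) * expR (gronwall_rate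
    X * (b - a)) /\
  diff_form 1 1 1 (u a) (v a) <= diff_form 1 1 1 (u b) (v b) * expR (gronwall_rate
    X * (b - a)).
Proof.
move=> ab su sv bu bv.
have bd t : a < t < b -> `|diff_form' 1 1 1 (u t) (v t)| <= gronwall_rate X *
  diff_form 1 1 1 (u t) (v t).
  move=> /andP[at_ tb]; have tab := itv_oo_cc at_ tb; apply: diff_form'_bound.
    by have [-> _ _] := sol_orthant su tab; have [-> _ _] := bu _ tab.
  by have [_ -> _] := sol_orthant sv tab; have [_ -> _] := bv _ tab.
split.
  have := comparison_upper (f := fun s => diff_form 1 1 1 (u s) (v s))
    (df := fun s => diff_form' 1 1 1 (u s) (v s)) (c := 0) (r := - gronwall_rate X) ab.
  rewrite !subr0 mulNr opprK; apply; first exact: diff_form_within.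
    by move=> t tab; exact: diff_form_derive su sv tab.
  by move=> t /bd; rewrite ler_norml sub0r mulrNN => /andP[].
have := comparison_lower (f := fun s => diff_form 1 1 1 (u s) (v s))
  (df := fun s => diff_form' 1 1 1 (u s) (v s)) (c := 0) (r := gronwall_rate X) ab.
rewrite !subr0 expRN -ler_pdivlMr ?invr_gt0 ?expR_gt0 // invrK; apply;
  first exact: diff_form_within.
  by move=> t tab; exact: diff_form_derive su sv tab.
by move=> t /bd; rewrite ler_norml sub0r mulrN => /andP[].
Qed.

(** Its nonpositive set is a cone around the direction of x, the expanding direction
at the origin. *)
Definition cone_form p q : R := diff_form (- (4 / k)) k3^-1 k5^-1 p q.

(** Near the origin the term - (4 / k) (dx)^2 decreases at rate at least 4 (dx)^2,
which absorbs the coupling of dx to dy and dz, while dy and dz are damped by their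
own equations. *)
Lemma cone_nincr a b u v : a <= b -> sol a b u -> sol a b v ->
  (forall t, a <= t <= b -> xc (u t) <= k / 8) ->
  (forall t, a <= t <= b -> yc (v t) <= k / 2) ->
  cone_form (u b) (v b) <= cone_form (u a) (v a).
Proof.
move=> ab su sv bu bv.
have := comparison_upper (f := fun s => cone_form (u s) (v s))
    (df := fun s => diff_form' (- (4 / k)) k3^-1 k5^-1 (u s) (v s)) (c := 0) (r :=
      0) ab.
rewrite !subr0 !mul0r oppr0 expR0 mulr1; apply; first exact: diff_form_within.
  by move=> t tab; exact: diff_form_derive su sv tab.
move=> t /andP[at_ tb]; have tab := itv_oo_cc at_ tb.
have xk := bu _ tab; have yk := bv _ tab.
have [x0 _ _] := sol_orthant su tab; have [_ y0 _] := sol_orthant sv tab.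
rewrite mul0r /diff_form'; move: xk yk x0 y0.
set p := u t; set q := v t.
set dx := xc p - xc q; set dy := yc p - yc q; set dz := zc p - zc q => xk yk x0 y0.
have -> : k3^-1 * dy * (k3 * (dz - dy)) = dy * (dz - dy).
  by field; rewrite lt0r_neq0.
have -> : k5^-1 * dz * (k5 * (dx - dz)) = dz * (dx - dz).
  by field; rewrite lt0r_neq0.
have -> : - (4 / k) * dx * (k * dx - xc p * dy - yc q * dx) =
  - 4 * dx ^+ 2 + 4 * (xc p / k) * (dx * dy) + 4 * (yc q / k) * dx ^+ 2.
  by field; rewrite lt0r_neq0.
(* After division by k the form depends on x / k and y / k only. *)
have : xc p / k <= 8^-1 by rewrite ler_pdivrMr // mulrC.
have : yc q / k <= 2^-1 by rewrite ler_pdivrMr // mulrC.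
have : 0 <= xc p / k by rewrite divr_ge0 // ltW.
have : 0 <= yc q / k by rewrite divr_ge0 // ltW.
set X := xc p / k; set Y := yc q / k => Y0 X0 Y2 X8.
have h1 := mulr_ge0 X0 (sqr_ge0 (dx - dy)).
have h2 : 0 <= (8^-1 - X) * (dx ^+ 2 + dy ^+ 2)
  by rewrite mulr_ge0 ?subr_ge0 ?addr_ge0 ?sqr_ge0.
have h3 : 0 <= (2^-1 - Y) * (dx ^+ 2) by rewrite mulr_ge0 ?subr_ge0 ?sqr_ge0.
have h4 := sqr_ge0 (dy - dz); have h5 := sqr_ge0 (dx - dz).
have sx := sqr_ge0 dx; have sy := sqr_ge0 dy; have sz := sqr_ge0 dz.
lra.
Qed.

(** * Norms and Lipschitz dependence on the initial point *)

Lemma norm3_le p r : (`|p| <= r) = [&& `|xc p| <= r, `|yc p| <= r & `|zc p| <= r].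
Proof. by rewrite !prod_normE !ge_max /= -andbA. Qed.

Lemma norm3_coord p : [/\ `|xc p| <= `|p|, `|yc p| <= `|p| & `|zc p| <= `|p|].
Proof. by apply/and3P; rewrite -norm3_le. Qed.

Lemma cvg3 (T : Type) (F : set_system T) {FF : Filter F} (f : T -> R3 R) p :
  xc (f t) @[t --> F] --> xc p -> yc (f t) @[t --> F] --> yc p ->
  zc (f t) @[t --> F] --> zc p -> f t @[t --> F] --> p.
Proof.
move=> /cvgrPdist_le fx /cvgrPdist_le fy /cvgrPdist_le fz.
apply/cvgrPdist_le => e e0; near=> t.
by rewrite norm3_le; apply/and3P; split; near: t; [exact: fx|exact: fy|exact: fz].
Unshelve. all: by end_near. Qed.

Lemma below_norm p : below `|p| p.
Proof. by have [? ? ?] := norm3_coord p; split; apply: le_trans (ler_norm _) _. Qed.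

Lemma below_orthant_norm X p : orthant p -> below X p -> `|p| <= X.
Proof.
by move=> [x0 y0 z0] [xX yX zX]; rewrite norm3_le !ger0_norm // xX yX zX.
Qed.

Lemma diff_form_le_norm p q : diff_form 1 1 1 p q <= 3 * `|p - q| ^+ 2.
Proof.
have [hx hy hz] := norm3_coord (p - q).
have sq (c : R) : `|c| <= `|p - q| -> c ^+ 2 <= `|p - q| ^+ 2.
  by move=> ?; rewrite -[c ^+ 2]real_normK ?num_real // lerXn2r // ?nnegrE.
have -> : 3 * `|p - q| ^+ 2 = `|p - q| ^+ 2 + `|p - q| ^+ 2 + `|p - q| ^+ 2 by ring.
by rewrite /diff_form !mul1r !lerD // sq.
Qed.

Lemma norm_le_diff_form p q : `|p - q| ^+ 2 <= diff_form 1 1 1 p q.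
Proof.
have wge0 : 0 <= diff_form 1 1 1 p q by rewrite /diff_form !mul1r !addr_ge0 ?sqr_ge0.
have sq (c : R) : c ^+ 2 <= diff_form 1 1 1 p q ->
  `|c| <= Num.sqrt (diff_form 1 1 1 p q).
  by move=> H; rewrite -sqrtr_sqr ler_sqrt.
suff : `|p - q| <= Num.sqrt (diff_form 1 1 1 p q).
  by rewrite -{2}(sqr_sqrtr wge0) => H; rewrite lerXn2r ?nnegrE ?sqrtr_ge0.
have s1 := sqr_ge0 (xc p - xc q); have s2 := sqr_ge0 (yc p - yc q).
have s3 := sqr_ge0 (zc p - zc q).
by rewrite norm3_le; apply/and3P; split; apply: sq; rewrite /diff_form !mul1r;
  [rewrite -addrA lerDl addr_ge0| rewrite addrAC lerDr addr_ge0|rewrite lerDr addr_ge0].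
Qed.

Definition lipschitz_const (X s : R) : R :=
  3 * expR (gronwall_rate (X * expR (k * s)) * s).

Lemma lipschitz_const_gt0 X s : 0 < lipschitz_const X s.
Proof. by rewrite mulr_gt0 // expR_gt0. Qed.

Lemma sol_norm a b u X t : sol a b u -> `|u a| <= X -> a <= t <= b ->
  below (X * expR (k * (b - a))) (u t).
Proof.
move=> su uX /andP[at_ tb].
have X0 : 0 <= X by apply: le_trans uX.
have bX : below X (u a).
  by have [x y z] := below_norm (u a); split; apply: le_trans uX.
have [x y z] := sol_below at_ (sol_sub (lexx _) tb su) X0 bX.
have e : X * expR (k * (t - a)) <= X * expR (k * (b - a)).
  by rewrite ler_wpM2l // ler_expR ler_wpM2l ?(ltW hk) // lerD2r.
by split; [exact: le_trans x e|exact: le_trans y e|exact: le_trans z e].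
Qed.

(** The bound X on the initial points controls both solutions up to time b, so the
constant depends only on X and b - a. *)
Lemma sol_lipschitz a b u v X : a <= b -> sol a b u -> sol a b v ->
  `|u a| <= X -> `|v a| <= X ->
  `|u b - v b| <= lipschitz_const X (b - a) * `|u a - v a| /\
  `|u a - v a| <= lipschitz_const X (b - a) * `|u b - v b|.
Proof.
move=> ab su sv uX vX.
have [fw bw] := gronwall ab su sv (fun t => sol_norm su uX) (fun t => sol_norm sv vX).
have X0 : 0 <= X by apply: le_trans uX.
set E := expR _ in fw bw; have E1 : 1 <= E.
  rewrite -expR0 ler_expR mulr_ge0 ?subr_ge0 // /gronwall_rate.
  have : 0 <= X * expR (k * (b - a)) by rewrite mulr_ge0 // expR_ge0.
  by move: hk hk3 hk5; lra.
have LE : lipschitz_const X (b - a) = 3 * E by [].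
have key (p q p' q' : R3 R) : diff_form 1 1 1 p q <= diff_form 1 1 1 p' q' * E ->
  `|p - q| <= 3 * E * `|p' - q'|.
  move=> H; rewrite -(@ler_pXn2r _ 2) ?nnegrE ?mulr_ge0 // ?(le_trans ler01) //.
  apply: le_trans (norm_le_diff_form p q) _; apply: le_trans H _.
  apply: le_trans (_ : 3 * `|p' - q'| ^+ 2 * E <= _).
    by rewrite ler_wpM2r ?(le_trans ler01) // diff_form_le_norm.
  set D := `|_|; rewrite -subr_ge0.
  have -> : (3 * E * D) ^+ 2 - 3 * D ^+ 2 * E = 3 * D ^+ 2 * (E * (3 * E - 1)) by ring.
  apply: mulr_ge0; first by rewrite mulr_ge0 // sqr_ge0.
  apply: mulr_ge0; lra.
by rewrite LE; split; exact: key.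
Qed.

Lemma sol_unique a b u v : a <= b -> sol a b u -> sol a b v ->
  u a = v a -> u b = v b.
Proof.
move=> ab su sv E; have := sol_lipschitz (X := `|u a|) ab su sv (lexx _).
rewrite -E => /(_ (lexx _)) [+ _]; rewrite subrr normr0 mulr0 normr_le0 subr_eq0.
by move/eqP.
Qed.

Lemma sol_unique_backward a b u v : a <= b -> sol a b u -> sol a b v ->
  u b = v b -> u a = v a.
Proof.
move=> ab su sv E.
have uX : `|u a| <= `|u a| + `|v a| by rewrite lerDl.
have vX : `|v a| <= `|u a| + `|v a| by rewrite lerDr.
have [_] := sol_lipschitz ab su sv uX vX.
by rewrite E subrr normr0 mulr0 normr_le0 subr_eq0 => /eqP.
Qed.

(** * Time shifts and uniform persistence *)

Lemma solution_on_shift (I J : set R) u s : (forall t, J t -> I (t + s)) ->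
  solution_on k k3 k5 I u -> solution_on k k3 k5 J (fun t => u (t + s)).
Proof.
move=> JI [cu ou du].
have cs t : (x + s) @[x --> t] --> t + s by apply: cvgD; [exact: cvg_id|exact: cvg_cst].
split.
- apply/subspace_continuousP => t Jt U Ut.
  have /subspace_continuousP/(_ _ (JI _ Jt)) := cu.
  move=> /(_ _ Ut) /cs IU.
  have IU' : \forall x \near t, I (x + s) -> U (u (x + s)) by exact: IU.
  suff : \forall x \near t, J x -> U (u (x + s)) by [].
  by apply: filterS IU' => x + Jx; apply; exact: JI.
- by move=> t /JI /ou.
- move=> t Jt.
  have It : I° (t + s).
    have : nbhs (t + s) (fun y => J (y - s)).
      have : (y - s) @[y --> t + s] --> t.
        rewrite -{2}(addrK s t); apply: cvgB; [exact: cvg_id|exact: cvg_cst].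
      by move=> /(_ _ Jt).
    by apply: filterS => y /JI; rewrite subrK.
  have [dx dy dz] := du _ It.
  have ds : is_derive t 1 (fun x : R => x + s) 1.
    by apply: is_derive_eq; rewrite addr0.
  have sh (f : R -> R) d : is_derive (t + s) 1 f d ->
    is_derive t 1 (fun x => f (x + s)) d.
    by move=> df; rewrite -[d]mulr1; apply: is_derive1_comp.
  by split; apply: sh.
Qed.

Lemma half_sol u a b : solution_on k k3 k5 `[0, +oo[ u -> 0 <= a -> sol a b u.
Proof.
move=> su a0; apply: solution_on_sub su => t /itvcc /andP[at_ _].
by rewrite /= in_itv /= andbT (le_trans a0).
Qed.

Lemma full_sol u a b : solution_on k k3 k5 setT u -> sol a b u.
Proof. exact: solution_on_sub. Qed.

Lemma full_shift u s : solution_on k k3 k5 setT u ->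
  solution_on k k3 k5 setT (fun t => u (t + s)).
Proof. exact: solution_on_shift. Qed.

Lemma full_orthant u t : solution_on k k3 k5 setT u -> orthant (u t).
Proof. by move=> [_ + _]; exact. Qed.

Lemma uniform_persistence : uniformly_persistent k k3 k5.
Proof.
have W0 : 0 < 2 * threshold by apply: mulr_gt0 => //; exact: threshold_gt0.
have [e e0 He] : exists2 e : R, 0 < e & forall a b u, a + 2 <= b -> sol a b u ->
   (forall t, a <= t <= b -> (2 * threshold)^-1 <= xc (u t)) -> e <= mincoord (u b).
  by apply: interior_bound; rewrite invr_gt0.
exists (e / 2); first by rewrite divr_gt0.
move=> u su; rewrite /mincoord !lt_min => /andP[x0 _].
have [T T0 HT] := eventually_persistent `|u 0| x0.
apply: (@lt_le_trans _ _ e%:E); first by rewrite lte_fin; lra.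
have eW : (e%:E <= ereal_inf ((fun t => (mincoord (u t))%:E) @` [set t : R | (T + 2
  < t)%R]))%E.
  apply: le_ereal_inf_tmp => _ [t /= Tt <-]; rewrite lee_fin.
  apply: (He T); [exact: ltW|exact: half_sol su T0|].
  move=> s /andP[Ts st]; have s0 : 0 <= s by apply: le_trans Ts.
  have := HT 0 s u.
  rewrite add0r => /(_ Ts (half_sol s su (lexx _)) (below_norm _) (lexx _)) [_ gs].
  apply: persistent_x_ge gs.
  by have [_ + _] := su; apply; rewrite /= in_itv /= s0.
apply: le_trans eW _; rewrite limf_einfE; apply: ereal_sup_ubound.
exists [set t | T + 2 < t] => //.
by exists (T + 2); split => //; exact: num_real.
Qed.

(** * Attraction in terms of distances *)

Lemma bounded3P (B : set (R3 R)) :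
  bounded_set B <-> exists M, forall p, B p -> `|p| <= M.
Proof.
split=> [[M [_ BM]]|[M BM]].
  by exists (M + 1) => p Bp; apply: (BM (M + 1)); rewrite ?ltrDl.
exists M; split=> [|y My p /BM pM]; first exact: num_real.
exact: le_trans pM (ltW My).
Qed.

Definition close_to (e : R) (K : set (R3 R)) p := exists2 q, K q & `|p - q| < e.

Lemma close_to_edist e K p : 0 < e -> close_to e K p -> (edist_inf K p <= e%:E)%E.
Proof.
move=> e0 [q Kq pq]; apply: le_trans (ereal_inf_lbound _) (edist_fin e0 _ : (edist
  (p, q) <= _)%E).
  by exists q.
by rewrite /= -ball_normE.
Qed.

Lemma edist_close_to e K p : (edist_inf K p < e%:E)%E -> close_to e K p.
Proof.
move=> /ereal_inf_lt [_ [q Kq <-]] /edist_lt_ball /=; rewrite -ball_normE => pq.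
by exists q.
Qed.

Lemma cvge0P (f : R -> \bar R) : (forall t, 0 <= f t)%E ->
  f t @[t --> +oo%R] --> 0%E <->
  forall e : R, 0 < e -> exists T, forall t, T < t -> (f t <= e%:E)%E.
Proof.
move=> f0; split=> [cf e e0|H U].
  have : nbhs 0%E [set x : \bar R | (x < e%:E)%E].
    by apply: open_ereal_lt'; rewrite lte_fin.
  move=> /cf [T [_ HT]]; exists T => t /HT; exact: ltW.
rewrite /nbhs /= => /nbhs_ballP [e /= e0 eU].
have [T HT] := H (e / 2) (divr_gt0 e0 (ltr0Sn _ 1)).
exists T; split; first exact: num_real.
move=> t /HT; move: (f0 t) => /=; case: (f t) => //= r.
rewrite !lee_fin => r0 re; apply: eU; rewrite -ball_normE /= sub0r normrN ger0_norm //.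
lra.
Qed.

(** The supremum of extended distances is replaced by a uniform approximation of
phi t p by points of K. *)
Lemma attractsP (phi : R -> R3 R -> R3 R) K B : attracts phi K B <->
  forall e : R, 0 < e -> exists T, forall t p, T < t -> B p -> close_to e K (phi t p).
Proof.
rewrite /attracts cvge0P; last first.
  by move=> t; apply: ereal_sup_ubound; left.
split=> H e e0.
  have [T HT] := H _ (divr_gt0 e0 (ltr0Sn _ 1) : 0 < e / 2); exists T => t p Tt Bp.
  apply: edist_close_to; apply: (@le_lt_trans _ _ (e / 2)%:E);
    last by rewrite lte_fin; lra.
  apply: le_trans (HT t Tt); apply: ereal_sup_ubound; right.
  by exists (phi t p) => //; exists p.
have [T HT] := H e e0; exists T => t Tt.
apply: ge_ereal_sup => _ [->|[_ [p Bp <-] <-]]; first by rewrite lee_fin ltW.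
exact: close_to_edist (HT _ _ Tt Bp).
Qed.

Lemma closed_close_to K p : closed K -> (forall e, 0 < e -> close_to e K p) -> K p.
Proof.
move=> cK H; apply: cK => U /nbhs_normP [e /= e0 eU].
have [q Kq pq] := H e e0; exists q; split => //; apply: eU.
by rewrite /= in pq *.
Qed.

Lemma equilibrium_solution p (I : set R) : orthant p -> vfield p = 0 ->
  solution_on k k3 k5 I (fun=> p).
Proof.
move=> op fp; split=> [t|//|t _]; first exact: cvg_cst.
have z (c d : R) : d = 0 -> is_derive t (1 : R) (fun=> c) d.
  by move=> ->; exact: is_derive_cst.
by split; apply: z; [have := congr1 (@xc R) fp|have := congr1 (@yc R) fp|have :=
  congr1 (@zc R) fp].
Qed.

Lemma zero_solution (I : set R) : solution_on k k3 k5 I (fun=> (0 : R3 R)).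
Proof.
apply: equilibrium_solution; first by split; rewrite lexx.
by rewrite /vfield /xc /yc /zc /= !subrr !mulr0 subrr.
Qed.

(** * The semiflow *)

Section Flow.
Context {phi : R -> R3 R -> R3 R} (Hphi : solution_semiflow k k3 k5 phi).

Lemma phi_solution p : orthant p -> solution_on k k3 k5 `[0, +oo[ (phi ^~ p).
Proof. by move=> /Hphi []. Qed.

Lemma phi0 p : orthant p -> phi 0 p = p.
Proof. by move=> /Hphi []. Qed.

Lemma phi_orthant t p : 0 <= t -> orthant p -> orthant (phi t p).
Proof.
by move=> t0 /phi_solution [_ + _]; apply; rewrite /= in_itv /= t0.
Qed.

Lemma sol_phi u a b : a <= b -> sol a b u -> u b = phi (b - a) (u a).
Proof.
move=> ab su.
have oa : orthant (u a) by apply: sol_orthant su _; rewrite lexx.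
apply: (sol_unique ab su (v := fun t => phi (t - a) (u a))); last first.
  by rewrite subrr phi0.
apply: solution_on_shift (phi_solution oa) => t /itvcc /andP[at_ _].
by rewrite /= in_itv /= subr_ge0 at_.
Qed.

Lemma phi_add p s t : 0 <= s -> 0 <= t -> orthant p ->
  phi (s + t) p = phi t (phi s p).
Proof.
move=> s0 t0 op; have := sol_phi (u := phi ^~ p) (a := s) (b := s + t).
rewrite lerDl addrAC subrr add0r; apply => //.
exact: half_sol (phi_solution op) s0.
Qed.

Lemma phi_lipschitz X t p q : 0 <= t -> orthant p -> orthant q ->
  `|p| <= X -> `|q| <= X ->
  `|phi t p - phi t q| <= lipschitz_const X t * `|p - q| /\
  `|p - q| <= lipschitz_const X t * `|phi t p - phi t q|.
Proof.
move=> t0 op oq pX qX.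
have := sol_lipschitz t0 (half_sol t (phi_solution op) (lexx _))
  (half_sol t (phi_solution oq) (lexx _)) (X := X).
by rewrite !phi0 // subr0; apply.
Qed.

(** Backward uniqueness: this is what allows orbits in A to be continued uniquely to
negative times. *)
Lemma phi_inj t p q : 0 <= t -> orthant p -> orthant q ->
  phi t p = phi t q -> p = q.
Proof.
move=> t0 op oq E.
have := sol_unique_backward t0 (half_sol t (phi_solution op) (lexx _))
  (half_sol t (phi_solution oq) (lexx _)) E.
by rewrite !phi0.
Qed.

Lemma phi_continuous t : 0 <= t -> {within orthant, continuous (phi t)}.
Proof.
move=> t0; apply/subspace_continuousP => p op; apply/cvgrPdist_lt => e e0.
pose L := lipschitz_const (`|p| + 1) t; have L0 : 0 < L := lipschitz_const_gt0 _ _.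
rewrite near_withinE; near=> q => oq.
have pq1 : `|p - q| < 1.
  by near: q; apply: cvgr_dist_lt => //; exact: cvg_id.
have pqe : `|p - q| < e / L.
  by near: q; apply: cvgr_dist_lt; [exact: cvg_id|exact: divr_gt0].
have qX : `|q| <= `|p| + 1.
  have -> : q = p - (p - q) by rewrite opprB addrC subrK.
  by apply: le_trans (ler_normB _ _) _; rewrite lerD2l ltW.
have pX : `|p| <= `|p| + 1 by rewrite lerDl.
have [H _] := phi_lipschitz t0 op oq pX qX.
by apply: le_lt_trans H _; rewrite -/L mulrC -ltr_pdivlMr.
Unshelve. all: by end_near. Qed.

(** On the face x = 0, z decays on its own and y follows z. *)
Lemma face_attracted B : B `<=` faceS -> bounded_set B -> attracts phi [set 0] B.
Proof.
move=> BS /bounded3P [X BX]; apply/attractsP => e e0.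
have e30 : 0 < e / 3 by lra.
have [T1 T10 H1] := decay_to X 0 hk5 e30.
have [T2 T20 H2] := decay_to (X * expR (k * T1)) (e / 3) hk3 e30.
exists (T1 + T2) => t p Tt /[dup] Bp /BS [op x0]; exists 0 => //.
rewrite subr0.
have t0 : 0 <= t by move: (addr_ge0 T10 T20) Tt => ? ?; lra.
have sp a b : 0 <= a -> sol a b (phi ^~ p) := half_sol b (phi_solution op).
have xs s : 0 <= s -> xc (phi s p) <= 0.
  move=> s0; have := sol_x_upper s0 (sp 0 s (lexx _)).
  by rewrite phi0 // x0 mul0r.
have p0 : phi 0 p = p := phi0 op.
have zs s : T1 <= s -> zc (phi s p) <= e / 3.
  move=> Ts; have s0 : 0 <= s by apply: le_trans Ts.
  rewrite -[leRHS]add0r; apply: (H1 (zc p) _ (s - 0)); rewrite ?subr0 //.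
    by have [_ _ zp] := norm3_coord p; apply: le_trans (ler_norm _) (le_trans zp
      (BX _ Bp)).
  have := @sol_z_upper 0 s (phi ^~ p) 0 s0 (sp 0 s (lexx _)).
  by rewrite p0 !subr0; apply => r /andP[r0 _]; exact: xs.
have T1t : T1 <= t by lra.
have ys : yc (phi t p) <= e / 3 + e / 3.
  apply: (H2 (yc (phi T1 p)) _ (t - T1)); last by lra.
    have pX : `|phi 0 p| <= X by rewrite p0; exact: BX.
    have := sol_norm (t := T1) (sp 0 T1 (lexx _)) pX.
    by rewrite T10 lexx subr0 => /(_ isT) [].
  apply: (@sol_y_upper T1 t (phi ^~ p)) => //; first exact: sp.
  by move=> s /andP[Ts _]; exact: zs.
apply: (@le_lt_trans _ _ (e / 3 + e / 3)); last by lra.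
apply: below_orthant_norm; first exact: phi_orthant.
split=> //.
- by apply: le_trans (xs _ t0) _; lra.
- by apply: le_trans (zs _ T1t) _; lra.
Qed.

(** * Complete orbits and the attractor *)

(** Forward, x decreases at a rate bounded on compact intervals; backward, x = 0 at
some time would force x = 0 later. *)
Lemma x_pos u s t : solution_on k k3 k5 setT u -> 0 < xc (u s) -> 0 < xc (u t).
Proof.
move=> su xs; have [st|/ltW ts] := leP s t.
  apply: lt_le_trans (sol_x_lower st (full_sol s t su)
      (Y := `|u s| * expR (k * (t - s))) _).
    by rewrite mulr_gt0 // expR_gt0.
  by move=> r rst; have [] := sol_norm (full_sol s t su) (lexx _) rst.
rewrite lt_neqAle eq_sym; have [-> _ _] := full_orthant t su; rewrite andbT.
apply: contraL xs => /eqP x0; rewrite -leNgt.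
by have := sol_x_upper ts (full_sol t s su); rewrite x0 mul0r.
Qed.

(** If y and z have a bounded past, their values are averages of the past of x, so a
bound e for x on the past passes to z and then to y. *)
Lemma past_small u M e T : solution_on k k3 k5 setT u ->
  (forall t, t <= T -> below M (u t)) -> (forall t, t <= T -> xc (u t) <= e) ->
  forall t, t <= T -> below e (u t).
Proof.
move=> su bM xe.
have ze t : t <= T -> zc (u t) <= e.
  move=> tT; apply/ler_addgt0Pr => d d0.
  have [s s0 Hs] := decay_to M e hk5 d0.
  have st : t - s <= t by rewrite gerBl.
  apply: (Hs (zc (u (t - s))) _ (t - (t - s))).
  - by have [] := bM (t - s) (le_trans st tT).
  - apply: sol_z_upper st (full_sol _ _ su) _ => r /andP[_ rt].
    exact: xe (le_trans rt tT).
  - by rewrite opprB addrC subrK.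
move=> t tT; split; [exact: xe| |exact: ze].
apply/ler_addgt0Pr => d d0.
have [s s0 Hs] := decay_to M e hk3 d0.
have st : t - s <= t by rewrite gerBl.
apply: (Hs (yc (u (t - s))) _ (t - (t - s))).
- by have [] := bM (t - s) (le_trans st tT).
- apply: sol_y_upper st (full_sol _ _ su) _ => r /andP[_ rt].
  exact: ze (le_trans rt tT).
- by rewrite opprB addrC subrK.
Qed.

Lemma full_unique u v : solution_on k k3 k5 setT u -> solution_on k k3 k5 setT v ->
  u 0 = v 0 -> u = v.
Proof.
move=> su sv E; apply/funext => t; have [t0|/ltW t0] := leP 0 t.
  exact: sol_unique t0 (full_sol _ _ su) (full_sol _ _ sv) E.
exact: sol_unique_backward t0 (full_sol _ _ su) (full_sol _ _ sv) E.
Qed.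

Lemma closed_persistent : closed persistent.
Proof.
have cf : continuous (fun p : R3 R => 2 * threshold * xc p - expR (lin 0 k3^-1
  k5^-1 p)).
  move=> p; apply: cvgB; first by apply: cvgM; [exact: cvg_cst|exact: xc_continuous].
  by apply: continuous_comp; [exact: lin_continuous|exact: continuous_expR].
have -> : persistent = (fun p : R3 R => 2 * threshold * xc p - expR (lin 0 k3^-1
  k5^-1 p)) @^-1` [set x | 0 <= x].
  apply/seteqP; split => p; rewrite /persistent /= subr_ge0 /lin mul0r add0r;
  by rewrite ![_^-1 * _]mulrC.
by apply: closed_comp => [p _|]; [exact: cf|exact: closed_ge].
Qed.

Definition cube (M : R) : set (R3 R) := [set p | orthant p /\ below M p].

Lemma compact_cube M : compact (cube M).
Proof.
have -> : cube M = (`[0, M] `*` `[0, M]) `*` `[0, M].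
  apply/seteqP; split => [p [[x0 y0 z0] [xM yM zM]]|p].
    by rewrite /setX /= !in_itv /= x0 y0 z0 xM yM zM.
  rewrite /setX /= !in_itv /= => -[[/andP[x0 xM] /andP[y0 yM]] /andP[z0 zM]].
  by split.
by apply: compact_setX; [apply: compact_setX|]; exact: segment_compact.
Qed.

Lemma hausdorff3 : hausdorff_space (R3 R).
Proof. exact: norm_hausdorff. Qed.

Context {A : set (R3 R)} (HA : compact_attractor phi A).

Lemma attractor_compact : compact A. Proof. by case: HA. Qed.

Lemma attractor_closed : closed A.
Proof. exact: compact_closed hausdorff3 attractor_compact. Qed.

Lemma attractor_orthant p : A p -> orthant p.
Proof. by case: HA => _ _ + _ _; exact. Qed.

Lemma attractor_phi t p : 0 <= t -> A p -> A (phi t p).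
Proof.
by move=> t0 Ap; case: HA => _ _ _ + _ => /(_ t t0) <-; exists p.
Qed.

Lemma attractor_preimage t p : 0 <= t -> A p -> exists2 q, A q & phi t q = p.
Proof.
by move=> t0 + ; case: HA => _ _ _ + _ => /(_ t t0) {1}<-.
Qed.

Lemma attractor_attracts B : B `<=` orthant -> bounded_set B -> attracts phi A B.
Proof. by case: HA => _ _ _ _; exact. Qed.

(** Every point of A has an arbitrarily long past in the bounded set A. *)
Lemma attractor_below p : A p -> below Mbound p.
Proof.
have /bounded3P [X AX] := compact_bounded attractor_compact.
have [T T0 HT] := ultimate_bound X => Ap.
have [q Aq <-] := attractor_preimage T0 Ap.
have oq := attractor_orthant Aq.
apply: (HT 0 T (phi ^~ q)); rewrite ?add0r //.
  exact: half_sol (phi_solution oq) (lexx _).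
rewrite phi0 //; have [x y z] := below_norm q; have := AX _ Aq.
by move=> qX; split; apply: le_trans qX.
Qed.

Lemma phi_full u s t : solution_on k k3 k5 setT u -> 0 <= t ->
  phi t (u s) = u (s + t).
Proof.
move=> su t0; have st : s <= s + t by rewrite lerDl.
by rewrite (sol_phi st (full_sol _ _ su)) addrAC subrr add0r.
Qed.

(** u 0 is phi t (u (- t)) for every t >= 0, and A attracts the bounded past of u. *)
Lemma bounded_past_in_attractor u : solution_on k k3 k5 setT u ->
  (exists M, forall t, t <= 0 -> `|u t| <= M) -> A (u 0).
Proof.
move=> su [M uM]; apply: closed_close_to; first exact: attractor_closed.
move=> e e0; have /attractsP/(_ _ e0) [T HT] : attracts phi A [set u t | t in [set
  t | t <= 0]].
  apply: attractor_attracts => [_ [t _ <-]|]; first exact: full_orthant su.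
  by apply/bounded3P; exists M => _ [t t0 <-]; exact: uM.
pose t := Num.max (T + 1) 0.
have t0 : 0 <= t by rewrite le_max lexx orbT.
have Tt : T < t by rewrite lt_max ltrDl ltr01.
have := HT t (u (- t)) Tt; rewrite phi_full // addNr; apply.
by exists (- t) => //=; rewrite oppr_le0.
Qed.

Lemma attractor_zero : A 0.
Proof.
apply: (@bounded_past_in_attractor (fun=> 0)); first exact: zero_solution.
by exists 0 => t _; rewrite normr0.
Qed.

Definition complete_orbit u := solution_on k k3 k5 setT u /\ forall t, A (u t).

Lemma complete_orbit_shift u s : complete_orbit u ->
  complete_orbit (fun t => u (t + s)).
Proof. by move=> [su Au]; split => //; exact: full_shift. Qed.

(** Invariance provides preimages in A at all times, and injectivity of phi glues them
into one orbit. *)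
Lemma complete_orbit_through p : A p -> exists2 u, complete_orbit u & u 0 = p.
Proof.
move=> Ap.
(* b T is the point of A that reaches p at time T; its values for T < 0 are junk. *)
have /choice [b Hb] : forall t, exists q, 0 <= t -> A q /\ phi t q = p.
  move=> t; have [t0|t0] := pselect (0 <= t); last by exists 0 => /t0.
  by have [q Aq E] := attractor_preimage t0 Ap; exists q.
pose u t := if 0 <= t then phi t p else b (- t).
have uE T t : 0 <= T -> - T <= t -> u t = phi (t + T) (b T).
  move=> T0 Tt; have [AbT EbT] := Hb T T0.
  have tT : 0 <= t + T by rewrite -lerBlDr sub0r.
  rewrite /u; case: ifPn => [t0|]; first by rewrite addrC phi_add ?EbT //;
    exact: attractor_orthant.
  rewrite -ltNge => /ltW t0; have nt : 0 <= - t by rewrite oppr_ge0.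
  have [Abt Ebt] := Hb (- t) nt.
  apply: (@phi_inj (- t)) => //; first exact: attractor_orthant.
    by apply: phi_orthant => //; exact: attractor_orthant.
  by rewrite Ebt -phi_add //; [rewrite addrAC subrr add0r EbT|exact: attractor_orthant].
have Au t : A (u t).
  by rewrite /u; case: ifPn => [t0|]; [exact: attractor_phi|rewrite -ltNge => t0;
    case: (Hb (- t)); rewrite ?oppr_ge0 ?ltW].
have su T : 0 <= T -> solution_on k k3 k5 `[- T, +oo[ u.
  move=> T0; have [/attractor_orthant obT _] := Hb T T0.
  have sh : solution_on k k3 k5 `[- T, +oo[ (fun t => phi (t + T) (b T)).
    apply: solution_on_shift (phi_solution obT) => t.
    by rewrite /= !in_itv /= !andbT -lerBlDr sub0r.
  have EU : {in `[- T, +oo[%classic, u =1 (fun t => phi (t + T) (b T))}.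
    by move=> t; rewrite inE /= in_itv /= andbT => /uE ->.
  have [cs os ds] := sh; split.
  - by move: cs; apply: subspace_eq_continuous => t /EU.
  - by move=> t _; exact: attractor_orthant (Au t).
  - move=> t It.
    have nE (F : R3 R -> R) d : is_derive t 1 (F \o (fun t =>
      phi (t + T) (b T))) d -> is_derive t 1 (F \o u) d.
      apply: near_eq_is_derive => //.
      have : nbhs t `[- T, +oo[%classic by exact: It.
      by apply: filterS => s Is /=; rewrite EU // inE.
    have -> : u t = phi (t + T) (b T) by apply: EU; rewrite inE;
      exact: nbhs_singleton It.
    by have [dx dy dz] := ds t It; split; exact: nE.
exists u; last by rewrite /u lexx phi0 //; exact: attractor_orthant.
split=> //.
have inter t : (`[- (`|t| + 1), +oo[%classic : set R)° t.
  rewrite interior_itv /= in_itv /= andbT ltrNl.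
  by apply: le_lt_trans (ler_norm _) _; rewrite normrN ltrDl.
have N t : 0 <= `|t| + 1 by rewrite addr_ge0.
split.
- apply: continuous_subspaceT => t.
  have [/subspace_continuousP cu _ _] := su _ (N t).
  have := cu t (interior_subset (inter t)).
  by rewrite within_interior.
- by move=> t _; exact: attractor_orthant (Au t).
- by move=> t _; have [_ _ +] := su _ (N t); exact.
Qed.

(** * The interior attractor *)

Lemma potential_orbit u a b : complete_orbit u -> 0 < xc (u a) -> a <= b ->
  potential (u b) - threshold <= (potential (u a) - threshold) * expR (- (k * (b - a))).
Proof.
move=> [su Au] xa ab; apply: potential_decay ab (full_sol _ _ su) _ xa => t _.
exact: attractor_below.
Qed.

(** By x_pos, x vanishes on the whole orbit, and past_small with bound 0 applies. *)
Lemma attractor_face p : A p -> xc p = 0 -> p = 0.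
Proof.
move=> /complete_orbit_through [u [su Au] <-] x0.
have xs t : xc (u t) <= 0.
  by rewrite leNgt; apply/negP => /(x_pos 0 su); rewrite x0 ltxx.
have H := past_small (T := 0) su (fun t _ => attractor_below (Au t)) (fun t _ =>
  xs t) (lexx _).
apply/eqP; rewrite -normr_le0; apply: below_orthant_norm H.
exact: full_orthant su.
Qed.

Lemma persistent_forward u s t : complete_orbit u -> s <= t -> persistent (u s) ->
  persistent (u t).
Proof.
move=> ou st /persistentP [xs ws]; apply/persistentP; split.
  by have [su _] := ou; apply: x_pos su xs.
have := potential_orbit ou xs st; set e := expR _ => H.
have e1 : e <= 1.
  by rewrite -expR0 ler_expR oppr_le0 mulr_ge0 ?subr_ge0 // ltW.
have e0 : 0 <= e := expR_ge0 _.
have W0 := threshold_gt0.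
have : (potential (u s) - threshold) * e <= threshold * e by rewrite ler_wpM2r //; lra.
have : threshold * e <= threshold by rewrite ler_piMr // ltW.
lra.
Qed.

(** Backward in time the excess of the potential over the threshold grows
exponentially, so x tends to 0, and y and z follow by past_small. *)
Lemma past_to_zero u s : complete_orbit u -> 0 < xc (u s) ->
  threshold < potential (u s) ->
  u t @[t --> -oo%R] --> (0 : R3 R).
Proof.
move=> ou xs ws; have [su Au] := ou.
apply/cvgrPdist_le => e e0.
have d0 : 0 < potential (u s) - threshold by lra.
pose K := expR (Mbound / k3 + Mbound / k5).
have [T T0 HT] := expR_decay (K / e / (potential (u s) - threshold)) hk ltr01.
exists (s - T); split; first exact: num_real.
move=> t tT; rewrite /= sub0r normrN; apply: below_orthant_norm;
  first exact: full_orthant su.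
apply: (past_small (T := s - T) su (fun t _ =>
  attractor_below (Au t)) _ (ltW tT)) => r rT.
have rs : r <= s by lra.
have xr : 0 < xc (u r) := x_pos r su xs.
have := potential_orbit ou xr rs.
have := HT (s - r); rewrite lerBrDl => /(_ _); rewrite -lerBrDr => /(_ rT).
rewrite expRN ler_pdivrMr ?expR_gt0 // mul1r ler_pdivrMr // => H1.
rewrite ler_pdivlMr ?expR_gt0 // mulrC => H2.
have Kw : K / e <= potential (u r) by have := threshold_gt0; lra.
have : potential (u r) <= K / xc (u r).
  rewrite /potential ler_wpM2r ?invr_ge0 ?(ltW xr) // ler_expR.
  by have [_ y z] := attractor_below (Au r); rewrite lerD // ler_pM2r ?invr_gt0.
move=> /(le_trans Kw); rewrite ler_pM2l ?expR_gt0 // lef_pV2 ?posrE //.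
Qed.

(** The points of A whose whole past is persistent. As an intersection of images of a
compact set it is visibly compact. *)
Definition interior_attractor : set (R3 R) :=
  \bigcap_(t in [set t | 0 <= t]) (phi t @` (A `&` persistent)).

Lemma interior_attractorP u : complete_orbit u ->
  interior_attractor (u 0) <-> forall t, persistent (u t).
Proof.
move=> ou; have [su Au] := ou; split=> [H t|H t /= t0]; last first.
  by exists (u (- t)); [split|rewrite phi_full // addNr].
pose s := Num.max 0 (- t).
have s0 : 0 <= s by rewrite le_max lexx.
have [q [Aq gq] E] := H s s0.
have Eq : q = u (- s).
  apply: (phi_inj s0); rewrite ?E ?phi_full ?addNr //; exact: attractor_orthant.
apply: (persistent_forward (s := - s) ou); last by rewrite -Eq.
by rewrite lerNl le_max lexx orbT.
Qed.

Lemma interior_attractor_orbit u t : complete_orbit u ->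
  interior_attractor (u 0) -> interior_attractor (u t).
Proof.
move=> ou /(interior_attractorP ou) H; have /interior_attractorP :=
  complete_orbit_shift t ou.
by rewrite add0r => ->.
Qed.

Lemma interior_attractor_sub p : interior_attractor p -> A p /\ persistent p.
Proof.
by move=> /(_ 0 (lexx 0)) [q [Aq gq] <-]; rewrite phi0 //; exact: attractor_orthant.
Qed.

Lemma compact_phi_image t K : 0 <= t -> K `<=` orthant -> compact K ->
  compact (phi t @` K).
Proof.
move=> t0 Ko; apply: continuous_compact.
exact: continuous_subspaceW Ko (phi_continuous t0).
Qed.

Lemma interior_attractor_compact : compact interior_attractor.
Proof.
apply: (subclosed_compact _ attractor_compact) => [|p /interior_attractor_sub []//].
apply: closed_bigI => t t0; apply: compact_closed hausdorff3 _.
apply: compact_phi_image => //; first by move=> p [/attractor_orthant].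
exact: compact_closedI attractor_compact closed_persistent.
Qed.

Lemma interior_attractor_invariant : flow_invariant phi interior_attractor.
Proof.
move=> t t0; apply/seteqP; split => [_ [p A1p <-]|p A1p].
  have [Ap _] := interior_attractor_sub A1p; have [u ou E] := complete_orbit_through Ap.
  rewrite -E phi_full // ?add0r; last by case: ou.
  by apply: interior_attractor_orbit => //; rewrite E.
have [Ap _] := interior_attractor_sub A1p; have [u ou E] := complete_orbit_through Ap.
exists (u (- t)); first by apply: interior_attractor_orbit => //; rewrite E.
by rewrite phi_full // ?addNr //; case: ou.
Qed.

Lemma interior_attractor_interior : interior_attractor `<=` orthant°.
Proof.
move=> p A1p; have [Ap _] := interior_attractor_sub A1p;
  have [u ou E] := complete_orbit_through Ap.
have [su _] := ou; move: A1p; rewrite -E => /(interior_attractorP ou) gu.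
have W0 : 0 < (2 * threshold)^-1.
  by rewrite invr_gt0; apply: mulr_gt0 => //; exact: threshold_gt0.
have [e e0 He] := interior_bound W0.
have : e <= mincoord (u 0).
  apply: (He (- 2)); [lra|exact: full_sol|].
  by move=> t _; apply: persistent_x_ge => //; exact: full_orthant su.
rewrite /mincoord !le_min => /and3P[x y z].
suff : \forall q \near u 0, orthant q by [].
apply/nbhs_normP; exists e => //= q /= uq.
have [dx dy dz] := norm3_coord (u 0 - q).
have aux (c d : R) : e <= c -> `|c - d| <= `|u 0 - q| -> 0 <= d.
  move=> ec cd; have := le_lt_trans (ler_norm _) (le_lt_trans cd uq); lra.
by split; [exact: (aux _ _ x)|exact: (aux _ _ y)|exact: (aux _ _ z)].
Qed.

Lemma x_lower_compact (B : set (R3 R)) : compact B -> B `<=` orthant ->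
  [disjoint B & faceS] -> exists2 xi : R, 0 < xi & forall p, B p -> xi <= xc p.
Proof.
move=> cB Bo dB.
have cx : closed (@xc R @` B).
  apply: compact_closed; first exact: Rhausdorff.
  by apply: continuous_compact => //; apply: continuous_subspaceT; exact: xc_continuous.
have n0 : (~` (@xc R @` B)) 0.
  move=> [p Bp x0]; have /disj_setPS/(_ p) := dB; apply; split => //.
  by split => //; exact: Bo.
have /nbhs_normP [e /= e0 He] : nbhs 0 (~` (@xc R @` B)).
  by apply: open_nbhs_nbhs; split => //; exact: closed_openC.
exists e => // p Bp; rewrite leNgt; apply/negP => xe.
have [x0 _ _] := Bo _ Bp.
by apply: (He (xc p)); [rewrite /= sub0r normrN ger0_norm|exists p].
Qed.

Lemma closure_subset_closed (E K : set (R3 R)) : closed K -> E `<=` K ->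
  closure E `<=` K.
Proof. by move=> /closure_id {2}-> /closureS. Qed.

Lemma closure_small (E : set (R3 R)) q e : 0 < e -> closure E q ->
  exists2 r, E r & `|q - r| < e.
Proof.
move=> e0 cl; have : \forall r \near q, `|q - r| < e.
  by apply/nbhs_normP; exists e.
by move=> /cl [r [Er qr]]; exists r.
Qed.

(** Every omega-limit point of B has a complete past among omega-limit points, which
are persistent because the orbits from B are eventually persistent, uniformly in
B. If some points of the orbits stayed far from the interior attractor, compactness
would produce an omega-limit point far from it. *)
Lemma interior_attractor_attracts B : compact B -> B `<=` orthant ->
  [disjoint B & faceS] ->
  attracts phi interior_attractor B.
Proof.
move=> cB Bo dB.
have [xi xi0 Bxi] := x_lower_compact cB Bo dB.
have /bounded3P [X BX] := compact_bounded cB.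
have [T0 T00 HT0] := eventually_persistent X xi0.
have ev t p : T0 <= t -> B p -> cube Mbound (phi t p) /\ persistent (phi t p).
  move=> Tt Bp; have op := Bo _ Bp.
  have t0 : 0 <= t by apply: le_trans Tt.
  have [] := HT0 0 t (phi ^~ p).
  - by rewrite add0r.
  - exact: half_sol (phi_solution op) (lexx _).
  - rewrite phi0 //; have [x y z] := below_norm p; have := BX _ Bp.
    by move=> pX; split; apply: le_trans pX.
  - by rewrite phi0 //; exact: Bxi.
  - by move=> *; split => //; split => //; exact: phi_orthant.
pose O s := [set q | exists t p, [/\ s <= t, B p & q = phi t p]].
have Ocube s : T0 <= s -> O s `<=` cube Mbound.
  by move=> Ts _ [t [p [st Bp ->]]]; have [] := ev t p (le_trans Ts st) Bp.
have ccube : closed (cube Mbound) := compact_closed hausdorff3 (@compact_cube _).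
have clO s : T0 <= s -> closure (O s) `<=` cube Mbound.
  by move=> /Ocube; exact: closure_subset_closed.
have cO s : T0 <= s -> compact (closure (O s)).
  move=> Ts; apply: (subclosed_compact _ (@compact_cube Mbound)); last exact: clO.
  exact: closed_closure.
have omega q : (forall s, T0 <= s -> closure (O s) q) -> interior_attractor q.
  move=> Hq t /= t0.
  have pre s : T0 <= s -> exists2 r, closure (O s) r & phi t r = q.
    move=> Ts; have Ocl : closed (phi t @` closure (O s)).
      apply: compact_closed hausdorff3 _; apply: compact_phi_image => //;
        last exact: cO.
      by move=> r /(clO _ Ts) [].
    have sub : O (s + t) `<=` phi t @` closure (O s).
      move=> _ [r [p [sr Bp ->]]]; exists (phi (r - t) p).
        by apply: subset_closure; exists (r - t), p; split; rewrite // lerBrDr.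
      have rt : 0 <= r - t by rewrite subr_ge0; apply: le_trans sr;
        rewrite lerDr (le_trans T00).
      by rewrite -phi_add // ?subrK //; exact: Bo.
    have : closure (O (s + t)) q by apply: Hq; apply: le_trans Ts _; rewrite lerDl.
    by move=> /(closure_subset_closed Ocl sub).
  (* The preimage of q found in closure (O s) is the same for every s. *)
  have [q' clq' E] := pre T0 (lexx _).
  have Hq' s : T0 <= s -> closure (O s) q'.
    move=> Ts; have [r clr Er] := pre s Ts.
    suff <- : r = q' by [].
    apply: (phi_inj t0); [by case: (clO _ Ts _ clr)| |by rewrite Er E].
    by case: (clO _ (lexx _) _ clq').
  exists q' => //; split; last first.
    apply: (closure_subset_closed closed_persistent _ clq') => _ [r [p [Tr Bp ->]]].
    by have [] := ev _ _ Tr Bp.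
  apply: closed_close_to; first exact: attractor_closed.
  move=> e e0; have e20 : 0 < e / 2 by lra.
  have : attracts phi A B by apply: attractor_attracts => //; apply/bounded3P; exists X.
  move=> /attractsP/(_ _ e20) [T HT].
  have Tm : T0 <= Num.max T0 (T + 1) by rewrite le_max lexx.
  have [_ [r [p [mr Bp ->]]] qr] := closure_small e20 (Hq' _ Tm).
  have Tr : T < r by apply: lt_le_trans mr; rewrite lt_max ltrDl ltr01 orbT.
  have [a Aa ra] := HT _ _ Tr Bp; exists a => //.
  have -> : q' - a = (q' - phi r p) + (phi r p - a) by rewrite addrA subrK.
  by apply: le_lt_trans (ler_normD _ _) _; lra.
apply/attractsP => e e0; apply: contrapT => noT.
pose E s := [set q | O s q /\ ~ close_to e interior_attractor q].
have E0 s : E s !=set0.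
  apply: contrapT => H; apply: noT; exists s => t p st Bp; apply: contrapT => nc.
  by apply: H; exists (phi t p); split => //; exists t, p; split => //; exact: ltW.
pose F := filter_from [set s | T0 <= s] E.
have FF : ProperFilter F.
  apply: filter_from_proper => [|s _]; last exact: E0.
  apply: filter_from_filter; first by exists T0 => /=.
  move=> s t Ts Tt; exists (Num.max s t); first by rewrite /= le_max Ts.
  move=> q [[r [p [+ Bp E1]]] nc]; rewrite ge_max => /andP[sr tr].
  by split; split => //; exists r, p.
have [] := @compact_cube Mbound F FF.
  by exists T0 => //= q [/(Ocube _ (lexx _))].
move=> q [_ clq].
have qcl s : T0 <= s -> closure (E s) q.
  by move=> Ts U Uq; apply: clq => //; exists s.
have A1q : interior_attractor q.
  apply: omega => s Ts; by apply: closureS (qcl s Ts) => r [].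
have [r [_ nr] qr] := closure_small e0 (qcl T0 (lexx _)).
by apply: nr; exists q => //; rewrite distrC.
Qed.

(** * The unstable branch of the origin *)

Definition unstable_branch : set (R3 R) := unstable_manifold0 k k3 k5 `\` [set 0].

Definition emanates u := u t @[t --> -oo%R] --> (0 : R3 R).

Lemma emanatesP u : emanates u <->
  forall e, 0 < e -> exists T, forall t, t < T -> `|u t| < e.
Proof.
split=> [/cvgrPdist_lt H e /H [T [_ HT]]|H].
  by exists T => t /HT; rewrite sub0r normrN.
apply/cvgrPdist_lt => e /H [T HT]; exists T; split; first exact: num_real.
by move=> t /HT /=; rewrite sub0r normrN.
Qed.

Lemma emanates_shift u s : emanates u -> emanates (fun t => u (t + s)).
Proof.
move=> /emanatesP H; apply/emanatesP => e /H [T HT]; exists (T - s) => t tT.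
by apply: HT; rewrite -ltrBrDr.
Qed.

Lemma emanates_complete_orbit u : solution_on k k3 k5 setT u -> emanates u ->
  complete_orbit u.
Proof.
move=> su eu; split=> // t; rewrite -[t]add0r.
apply: (@bounded_past_in_attractor (fun s => u (s + t))); first exact: full_shift.
have /emanatesP/(_ _ ltr01) [T HT] := emanates_shift t eu.
pose v s := u (s + t); have sv : solution_on k k3 k5 setT v := full_shift t su.
exists (1 * expR (k * (0 - (T - 1))) + 1) => s s0; rewrite -/(v s);
  have [Ts|sT] := leP T s.
  have va : `|v (T - 1)| <= 1 by apply: ltW; apply: HT; rewrite ltrBlDr ltrDl.
  have := sol_norm (t := s) (full_sol (T - 1) 0 sv) va.
  rewrite s0 andbT => /(_ _) H; apply: le_trans (_ : 1 * expR (k * (0 - (T - 1))) <= _).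
    apply: below_orthant_norm; first exact: full_orthant sv.
    by apply: H; lra.
  by rewrite lerDl.
apply: le_trans (ltW (HT _ sT)) _; rewrite lerDr mul1r; exact: expR_ge0.
Qed.

Lemma attractor_x_gt0 p : A p -> p <> 0 -> 0 < xc p.
Proof.
move=> Ap p0; rewrite lt_neqAle eq_sym; have [-> _ _] := attractor_orthant Ap.
by rewrite andbT; apply/eqP => /(attractor_face Ap).
Qed.

(** An orbit that leaves the origin has a bounded past, hence lies in A, and a nonzero
point of A has x > 0. *)
Lemma unstable_branchP p : unstable_branch p <-> exists u, [/\ complete_orbit u,
  emanates u, u 0 = p & 0 < xc p].
Proof.
split=> [[[u [su <- eu]] p0]|[u [[su Au] eu <- x0]]].
  have ou := emanates_complete_orbit su eu.
  by exists u; split => //; apply: attractor_x_gt0 => //; case: ou.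
by split; [exists u|move=> u0; move: x0; rewrite u0 ltxx].
Qed.

Lemma bad_in_unstable_branch p : A p -> 0 < xc p -> ~ persistent p -> unstable_branch p.
Proof.
move=> Ap x0 ng; have [u ou E] := complete_orbit_through Ap.
apply/unstable_branchP; exists u; split => //; apply: (@past_to_zero u 0) => //;
  rewrite E //.
rewrite ltNge; apply/negP => H; apply: ng; apply/persistentP; split => //.
by have := threshold_gt0; lra.
Qed.

Lemma unstable_branch_orbit u t : complete_orbit u -> emanates u -> 0 < xc (u 0) ->
  unstable_branch (u t).
Proof.
move=> ou eu x0; apply/unstable_branchP; exists (fun s => u (s + t)); split.
- exact: complete_orbit_shift.
- exact: emanates_shift.
- by rewrite add0r.
- by have [su _] := ou; apply: x_pos su x0.
Qed.

(** On persistent points x is bounded below. *)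
Lemma emanates_not_persistent u T : complete_orbit u -> emanates u -> exists2 t,
  t < T & ~ persistent (u t).
Proof.
move=> [su _] /emanatesP H.
have W0 : 0 < (2 * threshold)^-1.
  by rewrite invr_gt0; apply: mulr_gt0 => //; exact: threshold_gt0.
have [T' HT] := H _ W0; exists (Num.min T T' - 1).
  by rewrite ltrBlDr; apply: le_lt_trans (_ : T < _); rewrite ?ge_min ?lexx ?ltrDl.
set t := _ - 1 => gt; have tT' : t < T'.
  by rewrite ltrBlDr; apply: le_lt_trans (_ : T' < _);
    rewrite ?ge_min ?lexx ?orbT ?ltrDl.
have := persistent_x_ge (full_orthant t su) gt; have [xn _ _] := norm3_coord (u t).
have := HT _ tT'; have := ler_norm (xc (u t)); lra.
Qed.

Lemma unstable_branch_interior_attractor_disjoint : [disjoint unstable_branch &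
  interior_attractor].
Proof.
apply/disj_setPS => p [/unstable_branchP [u [ou eu E x0]]];
  rewrite -E => /(interior_attractorP ou) gu.
by have [t _] := emanates_not_persistent 0 ou eu.
Qed.

Lemma zero_unstable_branch_disjoint : [disjoint [set (0 : R3 R)] & unstable_branch].
Proof. by apply/disj_setPS => p [-> [_ /(_ erefl)]]. Qed.

Lemma zero_interior_attractor_disjoint : [disjoint [set (0 : R3 R)] &
  interior_attractor].
Proof.
by apply/disj_setPS => p [-> /interior_attractor_sub [_ /persistentP [+ _]]];
  rewrite ltxx.
Qed.

(** A complete orbit with x > 0 that leaves the persistent set once has potential
above the threshold there, so it comes from the origin. *)
Lemma attractor_decomposition : A = [set (0 : R3 R)] `|` unstable_branch `|`
  interior_attractor.
Proof.
apply/seteqP; split => p.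
  move=> Ap; have [->|/eqP p0] := eqVneq p 0; first by left; left.
  have [u ou E] := complete_orbit_through Ap; have x0 := attractor_x_gt0 Ap p0.
  have [gu|] := pselect (forall t, persistent (u t)).
    by right; rewrite -E; apply/(interior_attractorP ou).
  move=> /existsNP [t ngt]; left; right.
  have xt : 0 < xc (u t) by have [su _] := ou; apply: x_pos su (_ : 0 < xc (u 0));
    rewrite E.
  apply/unstable_branchP; exists u; split => //; apply: (@past_to_zero u t) => //.
  rewrite ltNge; apply/negP => H; apply: ngt; apply/persistentP; split => //.
  by have := threshold_gt0; lra.
move=> [[->|/unstable_branchP [u [[_ Au] _ <- _]]]|/interior_attractor_sub []//];
  first exact: attractor_zero.
exact: Au.
Qed.

Lemma unstable_branch_connects : connects0 k k3 k5 unstable_branch interior_attractor.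
Proof.
move=> p /unstable_branchP [u [ou eu E x0]]; exists u; have [su Au] := ou; split => //.
  by move=> t; apply: unstable_branch_orbit => //; rewrite E.
apply/cvge0P => [t|e e0]; first exact: edist_inf_ge0.
have /attractsP/(_ _ e0) [T HT] : attracts phi interior_attractor [set p].
  apply: interior_attractor_attracts; first exact: compact_set1.
    by move=> _ ->; rewrite -E; exact: full_orthant su.
  by apply/disj_setPS => q [-> [_ H]]; move: x0; rewrite H ltxx.
exists (Num.max T 0) => t; rewrite gt_max => /andP[Tt t0].
apply: close_to_edist => //; have := HT t p Tt erefl.
by rewrite -E phi_full ?add0r ?(ltW t0).
Qed.

(** A point of A at height 0 < x < 1 / (2 threshold) suffices: it is not persistent,
so its orbit comes from the origin. It is found as a point of A close to the image
of a segment. *)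
Lemma unstable_branch_nonempty : unstable_branch !=set0.
Proof.
have W0 : 0 < 2 * threshold by apply: mulr_gt0 => //; exact: threshold_gt0.
set d := (2 * threshold)^-1; have d0 : 0 < d by rewrite invr_gt0.
(* The image of the segment of the e s, 0 <= s <= 1, under phi t joins the origin
   to a point with x >= d, so it meets the height x = d / 2, and does so near A. *)
pose e (s : R) : R3 R := (s, 0, 0).
have oe s : 0 <= s -> orthant (e s) by move=> s0; split; rewrite /e /xc /yc /zc //=.
have ne s : `|e s| = `|s|.
  by apply/eqP; rewrite eq_le norm3_le /e /xc /yc /zc /= normr0 lexx normr_ge0 /=;
     have [] := norm3_coord (e s).
have d40 : 0 < d / 4 by lra.
have : attracts phi A [set e s | s in `[0, 1]].
  apply: attractor_attracts => [_ [s /itvcc /andP[s0 _] <-]|]; first exact: oe.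
  by apply/bounded3P; exists 1 => _ [s /itvcc /andP[s0 s1] <-]; rewrite ne ger0_norm.
move=> /attractsP/(_ _ d40) [T HT].
have [T' T'0 HT'] := eventually_persistent `|e 1| (ltr01 : 0 < 1 :> R).
pose t := Num.max T' (T + 1).
have t0 : 0 <= t by rewrite le_max T'0.
have Tt : T < t by rewrite lt_max ltrDl ltr01 orbT.
have f1 : d <= xc (phi t (e 1)).
  apply: persistent_x_ge; first exact: phi_orthant (oe _ ler01).
  have [] := HT' 0 t (phi ^~ (e 1)); rewrite ?add0r ?le_max ?lexx //.
  - exact: half_sol (phi_solution (oe _ ler01)) (lexx _).
  - by rewrite phi0; [exact: below_norm|exact: oe].
  - by rewrite phi0 //; exact: oe.
have f0 : xc (phi t (e 0)) = 0.
  have := sol_phi t0 (zero_solution `[0, t]); rewrite subr0 => E.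
  by rewrite -[e 0]/(0 : R3 R) -E.
have ce : continuous e.
  by move=> s; apply: cvg3; [exact: cvg_id|exact: cvg_cst|exact: cvg_cst].
have cf : {within `[0, 1], continuous (fun s => xc (phi t (e s)))}.
  have c1 : {within `[0, 1], continuous (phi t \o e)}.
    apply/subspace_continuousP => s /itvcc /andP[s0 s1].
    have /subspace_continuousP/(_ _ (oe _ s0)) := phi_continuous t0.
    move=> H U /H /(ce s) IU.
    have IU' : \forall x \near s, orthant (e x) -> U (phi t (e x)) by exact: IU.
    suff : \forall x \near s, x \in `[0, 1] -> U (phi t (e x)) by [].
    by apply: filterS IU' => x + /andP[x0 _]; apply; exact: oe.
  exact: (within_comp (F := @xc R) c1 (fun s _ => @xc_continuous _)).
have [s /itvcc /andP[s0 s1] fs] : exists2 s, s \in `[0, 1] & xc (phi t (e s)) = d / 2.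
  apply: IVT => //; rewrite f0 ge_min le_max; apply/andP; split; apply/orP;
    [left|right]; lra.
have [a Aa] : close_to (d / 4) A (phi t (e s)).
  by apply: HT => //; exists s => //; apply/itvcc; rewrite s0.
have [xn _ _] := norm3_coord (phi t (e s) - a) => H.
have := le_lt_trans xn H; rewrite ltr_norml [xc (_ - _)]/= -/(xc a) -/(xc (phi t (e
  s))) => /andP[h1 h2].
have h3 : xc (phi t (e s) - a) = xc (phi t (e s)) - xc a by [].
rewrite fs in h3.
exists a; apply: bad_in_unstable_branch => //; first lra.
by move=> /(persistent_x_ge (attractor_orthant Aa)); rewrite -/d; lra.
Qed.

(** * Uniqueness of the unstable orbit *)

Lemma cone_form_le p q : cone_form p q <= (k3^-1 + k5^-1) * (`|p| + `|q|) ^+ 2.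
Proof.
have [_ hy hz] := norm3_coord (p - q).
have n := ler_normB p q.
have sq (c : R) : `|c| <= `|p - q| -> c ^+ 2 <= (`|p| + `|q|) ^+ 2.
  move=> h; rewrite -[c ^+ 2]real_normK ?num_real // lerXn2r // ?nnegrE ?addr_ge0 //.
  exact: le_trans h n.
have h1 : k3^-1 * (yc p - yc q) ^+ 2 <= k3^-1 * (`|p| + `|q|) ^+ 2.
  by rewrite ler_wpM2l ?invr_ge0 ?(ltW hk3) //; exact: sq.
have h2 : k5^-1 * (zc p - zc q) ^+ 2 <= k5^-1 * (`|p| + `|q|) ^+ 2.
  by rewrite ler_wpM2l ?invr_ge0 ?(ltW hk5) //; exact: sq.
have h0 : 0 <= 4 / k * (xc p - xc q) ^+ 2.
  by rewrite mulr_ge0 ?sqr_ge0 // divr_ge0 // ltW.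
rewrite /cone_form /diff_form; lra.
Qed.

Lemma cone_form_eq p q : xc p = xc q -> cone_form p q <= 0 -> p = q.
Proof.
move=> xE; rewrite /cone_form /diff_form xE subrr expr0n mulr0 add0r => H.
have i3 : 0 < k3^-1 by rewrite invr_gt0.
have i5 : 0 < k5^-1 by rewrite invr_gt0.
have h1 := mulr_ge0 (ltW i3) (sqr_ge0 (yc p - yc q)).
have h2 := mulr_ge0 (ltW i5) (sqr_ge0 (zc p - zc q)).
have sq0 (c d : R) : 0 < c -> c * d ^+ 2 = 0 -> d = 0.
  by move=> c0 /eqP; rewrite mulf_eq0 gt_eqF //= sqrf_eq0 => /eqP.
have yE : yc p = yc q by apply/subr0_eq/(sq0 _ _ i3); lra.
have zE : zc p = zc q by apply/subr0_eq/(sq0 _ _ i5); lra.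
by move: p q xE yE zE {H h1 h2 i3 i5 sq0} => [[? ?] ?] [[? ?] ?];
  rewrite /xc /yc /zc /= => -> -> ->.
Qed.

(** The form is nonincreasing in time and tends to 0 in the far past, so it is
nonpositive at time 0, where the difference has no x-component. *)
Lemma same_x_same_orbit u v : solution_on k k3 k5 setT u ->
  solution_on k k3 k5 setT v ->
  emanates u -> emanates v ->
  (forall t, t <= 0 -> xc (u t) <= k / 8) -> (forall t, t <= 0 -> yc (v t) <= k / 2) ->
  xc (u 0) = xc (v 0) -> u = v.
Proof.
move=> su sv /emanatesP eu /emanatesP ev ux vy xE; apply: full_unique => //.
apply: cone_form_eq => //; apply/ler_addgt0Pr => e e0; rewrite add0r.
have i0 : 0 < k3^-1 + k5^-1 by rewrite addr_gt0 ?invr_gt0.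
have d0 : 0 < Num.min 1 (e / (k3^-1 + k5^-1) / 4).
  by rewrite lt_min ltr01 !divr_gt0.
have [T HT] := eu _ d0; have [T' HT'] := ev _ d0.
pose t := Num.min 0 (Num.min (T - 1) (T' - 1)).
have t0 : t <= 0 by rewrite ge_min lexx.
have tT : t < T.
  by apply: (@le_lt_trans _ _ (T - 1)); rewrite ?ltrBlDr ?ltrDl // !ge_min lexx orbT.
have tT' : t < T'.
  by apply: (@le_lt_trans _ _ (T' - 1)); rewrite ?ltrBlDr ?ltrDl // !ge_min lexx !orbT.
apply: le_trans (cone_nincr t0 (full_sol _ _ su) (full_sol _ _ sv) _ _) _.
- by move=> s /andP[_]; exact: ux.
- by move=> s /andP[_]; exact: vy.
apply: le_trans (cone_form_le _ _) _; rewrite mulrC -ler_pdivlMr //.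
have := HT _ tT; have := HT' _ tT'; rewrite !lt_min => /andP[v1 v2] /andP[u1 u2].
set a := `|u t| in u1 u2 *; set b := `|v t| in v1 v2 *.
have a0 : 0 <= a := normr_ge0 _; have b0 : 0 <= b := normr_ge0 _.
have : (a + b) * (a + b) <= 2 * (a + b) by rewrite ler_wpM2r ?addr_ge0 //; lra.
rewrite expr2; lra.
Qed.

(** Shifting the orbit with the larger x back in time makes the heights equal. *)
Lemma unstable_unique_le u v T : complete_orbit u -> complete_orbit v ->
  emanates u -> emanates v ->
  (forall t, t <= T -> `|u t| <= k / 8) -> (forall t, t <= T -> `|v t| <= k / 8) ->
  0 < xc (u T) -> xc (u T) <= xc (v T) ->
  exists s, forall t, v t = u (t + s).
Proof.
move=> [su _] [sv _] eu ev uk vk x0 xle.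
have /emanatesP/(_ _ x0) [S HS] := ev.
(* v starts below the height x (u T) and ends above it: match the heights. *)
pose a := Num.min T (S - 1).
have aT : a <= T by rewrite ge_min lexx.
have aS : a < S by apply: (@le_lt_trans _ _ (S - 1));
  rewrite ?ltrBlDr ?ltrDl // ge_min lexx orbT.
have va : xc (v a) <= xc (u T).
  by have [xn _ _] := norm3_coord (v a);
    apply: le_trans (ler_norm _) (le_trans xn (ltW (HS _ aS))).
have cv : {within `[a, T], continuous (xc \o v)}.
  by apply: within_comp => [|t _]; [case: (full_sol a T sv)|exact: xc_continuous].
have [r /itvcc /andP[ar rT] vr] : exists2 r, r \in `[a, T] & (xc \o v) r = xc (u T).
  by apply: IVT => //; rewrite ge_min le_max va xle orbT.
have E : (fun t => u (t + T)) = (fun t => v (t + r)).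
  apply: same_x_same_orbit; [exact: full_shift|exact: full_shift|exact:
    emanates_shift|exact: emanates_shift| | |].
  - move=> t t0; have [xn _ _] := norm3_coord (u (t + T)).
    by apply: le_trans (ler_norm _) (le_trans xn (uk _ _)); rewrite gerDr.
  - move=> t t0; have [_ yn _] := norm3_coord (v (t + r)).
    apply: le_trans (ler_norm _) (le_trans yn (le_trans (vk _ _) _));
      last by move: hk; lra.
    by apply: le_trans rT; rewrite gerDr.
  - by rewrite !add0r -vr.
exists (T - r) => t; have /(congr1 (fun f => f (t - r))) := E.
by rewrite /= subrK => <-; congr u; ring.
Qed.

Lemma unstable_unique u v : complete_orbit u -> complete_orbit v -> emanates u ->
  emanates v ->
  0 < xc (u 0) -> 0 < xc (v 0) -> exists s, forall t, v t = u (t + s).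
Proof.
move=> ou ov eu ev ux vx.
have k8 : 0 < k / 8 by rewrite divr_gt0.
have /emanatesP/(_ _ k8) [T HT] := eu; have /emanatesP/(_ _ k8) [T' HT'] := ev.
pose t := Num.min (T - 1) (T' - 1).
have tT : t < T by apply: (@le_lt_trans _ _ (T - 1));
  rewrite ?ltrBlDr ?ltrDl // ge_min lexx.
have tT' : t < T'.
  by apply: (@le_lt_trans _ _ (T' - 1)); rewrite ?ltrBlDr ?ltrDl // ge_min lexx orbT.
have uk s : s <= t -> `|u s| <= k / 8 by move=> st; apply/ltW/HT/(le_lt_trans st).
have vk s : s <= t -> `|v s| <= k / 8 by move=> st; apply/ltW/HT'/(le_lt_trans st).
have ut : 0 < xc (u t) by have [su _] := ou; exact: x_pos su ux.
have vt : 0 < xc (v t) by have [sv _] := ov; exact: x_pos sv vx.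
have [le|/ltW le] := leP (xc (u t)) (xc (v t)).
  exact: unstable_unique_le ou ov eu ev uk vk ut le.
have [s Hs] := unstable_unique_le ov ou ev eu vk uk vt le.
by exists (- s) => r; rewrite Hs subrK.
Qed.

(** Above the threshold the potential decreases along orbits, and it never rises back
above the threshold. *)
Lemma potential_antitone u s t : complete_orbit u -> 0 < xc (u 0) -> s <= t ->
  threshold <= potential (u s) \/ threshold <= potential (u t) -> potential (u t)
    <= potential (u s).
Proof.
move=> ou x0 st; have [su _] := ou.
have := potential_orbit ou (x_pos s su x0) st; set e := expR _ => H.
have e0 : 0 < e := expR_gt0 _.
have e1 : e <= 1 by rewrite -expR0 ler_expR oppr_le0 mulr_ge0 ?subr_ge0 // ltW.
have step : threshold <= potential (u s) -> potential (u t) <= potential (u s).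
  move=> h; have : (potential (u s) - threshold) * e <= potential (u s) - threshold.
    by rewrite ler_piMr // subr_ge0.
  lra.
move=> [|h]; first exact: step.
apply: step; rewrite -subr_ge0 -(pmulr_lge0 _ e0); lra.
Qed.

Lemma potential_strict u s t : complete_orbit u -> 0 < xc (u 0) -> s < t ->
  threshold < potential (u t) ->
  potential (u t) < potential (u s).
Proof.
move=> ou x0 st wt0; have [su _] := ou.
have := potential_orbit ou (x_pos s su x0) (ltW st); set e := expR _ => H.
have e0 : 0 < e := expR_gt0 _.
have e1 : e < 1 by rewrite -expR0 ltr_expR oppr_lt0 mulr_gt0 // subr_gt0.
have p0 : 0 < potential (u s) - threshold by rewrite -(pmulr_lgt0 _ e0); lra.
have : (potential (u s) - threshold) * e < potential (u s) - threshold
  by rewrite -[ltRHS]mulr1 ltr_pM2l.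
lra.
Qed.

Lemma past_potential_large u : complete_orbit u -> emanates u -> 0 < xc (u 0) ->
  exists T, forall t, t < T -> threshold < potential (u t).
Proof.
move=> [su _] /emanatesP eu x0.
have i0 : 0 < threshold^-1 by rewrite invr_gt0 threshold_gt0.
have [T HT] := eu _ i0; exists T => t /HT tT.
have xt := x_pos t su x0.
apply: lt_le_trans (inv_x_le_potential (full_orthant t su) xt).
rewrite -[ltLHS]invrK ltf_pV2 ?posrE //.
have [xn _ _] := norm3_coord (u t).
exact: le_lt_trans (ler_norm _) (le_lt_trans xn tT).
Qed.

(** Two equal points of the orbit would make it periodic, while the potential is
strictly decreasing in the far past. *)
Lemma emanates_inj u : complete_orbit u -> emanates u -> 0 < xc (u 0) -> injective u.
Proof.
move=> ou eu x0.
suff H s t : u s = u t -> ~ s < t.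
  move=> s t E; have [/(H _ _ E)//|/(H _ _ (esym E))//|//] := ltgtP s t.
move=> E st; have [su _] := ou.
have F : (fun r => u (r + s)) = (fun r => u (r + t)).
  by apply: full_unique; rewrite ?add0r //; exact: full_shift.
have [T HT] := past_potential_large ou eu x0.
have rT : (T - 1 - t) + t < T by rewrite subrK ltrBlDr ltrDl.
have := potential_strict ou x0 (_ : (T - 1 - t) + s < (T - 1 - t) + t) (HT _ rT).
rewrite ltrD2l => /(_ st); have /(congr1 (fun f => f (T - 1 - t))) /= -> := F.
by rewrite ltxx.
Qed.

Lemma is_derive_pair (V W : normedModType R) (f : R -> V) (g : R -> W) t df dg :
  is_derive t 1 f df -> is_derive t 1 g dg ->
  is_derive t 1 (fun s => (f s, g s)) (df, dg).
Proof.
move=> [/derivable1_diffP df' <-] [/derivable1_diffP dg' <-].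
apply: DeriveDef; first by apply/derivable1_diffP; exact: differentiable_pair.
by rewrite deriveE ?diff_pair ?deriveE //; exact: differentiable_pair.
Qed.

Lemma full_derive u t : solution_on k k3 k5 setT u ->
  is_derive t 1 u (vfield (u t)).
Proof.
move=> su; have tt : t - 1 < t < t + 1 by lra.
have [dx dy dz] := sol_derive (full_sol (t - 1) (t + 1) su) tt.
have -> : u = fun s => (((xc \o u) s, (yc \o u) s), (zc \o u) s).
  by apply/funext => s; rewrite /xc /yc /zc /=; case: (u s) => [[]].
exact: is_derive_pair (is_derive_pair dx dy) dz.
Qed.

Lemma vfield_continuous : continuous vfield.
Proof.
move=> p; apply: cvg3.
- apply: cvgB; apply: cvgM; try exact: cvg_cst; try exact: xc_continuous.
  exact: yc_continuous.
- by apply: cvgM; [exact: cvg_cst|apply: cvgB;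
  [exact: zc_continuous|exact: yc_continuous]].
- by apply: cvgM; [exact: cvg_cst|apply: cvgB;
  [exact: xc_continuous|exact: zc_continuous]].
Qed.

Lemma full_continuous u : solution_on k k3 k5 setT u -> continuous u.
Proof.
move=> su t; have [/derivable1_diffP d _] := full_derive t su.
exact: differentiable_continuous.
Qed.

(** * The unstable branch as an embedded curve *)

Section Orbit.
Context {u : R -> R3 R} (ou : complete_orbit u) (eu : emanates u) (ux : 0 < xc (u 0)).

Lemma unstable_branch_range : unstable_branch = range u.
Proof.
apply/seteqP; split => [p /unstable_branchP [v [ov ev <- vx]]|_ [t _ <-]];
  last exact: unstable_branch_orbit.
by have [s ->] := unstable_unique ou ov eu ev ux vx; exists (0 + s).
Qed.

Definition clock p : R := xget 0 [set t | u t = p].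

Lemma clockK t : clock (u t) = t.
Proof.
apply: (emanates_inj ou eu ux); rewrite /clock.
by apply: (@xgetPex _ 0 [set s | u s = u t]); exists t.
Qed.

(** A point q of the orbit close to u t0 stays close when both are moved back by r, so
the potentials there are close, and these determine the times. *)
Lemma clock_continuous : {within unstable_branch, continuous clock}.
Proof.
have [su Au] := ou; rewrite unstable_branch_range.
apply/subspace_continuousP => _ [t0 _ <-]; apply/cvgrPdist_lt => e e0.
rewrite near_withinE.
suff : \forall q \near u t0, range u q -> `|t0 - clock q| < e.
  by apply: filterS => q; rewrite /from_subspace clockK.
have [T HT] := past_potential_large ou eu ux.
(* Going back by time r brings the orbit into the region where the potential is
   strictly monotone along it, hence determines the time. *)
pose r := Num.max 0 (t0 + e - T + 1).
have r0 : 0 <= r by rewrite le_max lexx.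
have rT : t0 - r + e < T.
  have : t0 + e - T + 1 <= r by rewrite le_max lexx orbT.
  lra.
pose L := lipschitz_const Mbound r; have L0 : 0 < L := lipschitz_const_gt0 _ _.
have xr := x_pos (t0 - r) su ux.
have wlo : potential (u (t0 - r + e)) < potential (u (t0 - r)).
  by apply: potential_strict ou ux _ (HT _ rT); rewrite ltrDl.
have whi : potential (u (t0 - r)) < potential (u (t0 - r - e)).
  by apply: potential_strict ou ux _ (HT _ _); lra.
have [d d0 Hd] : exists2 d : R, 0 < d & forall q, `|u (t0 - r) - q| < d ->
    potential (u (t0 - r + e)) < potential q < potential (u (t0 - r - e)).
  have cw := potential_continuous xr.
  have : \forall q \near u (t0 - r), potential (u (t0 - r + e)) < potential q <
    potential (u (t0 - r - e)).
    near=> q; apply/andP; split; near: q.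
      exact: (cvgr_gt _ cw).
    exact: (cvgr_lt _ cw).
  by move=> /nbhs_normP [d /= d0 Hd]; exists d => // q qd; exact: Hd.
have nb : \forall q \near u t0, `|u t0 - q| < d / L.
  by apply/nbhs_normP; exists (d / L) => //=; exact: divr_gt0.
apply: filterS nb => _ /[swap] -[s _ <-]; rewrite clockK => close.
have key : `|u (t0 - r) - u (s - r)| < d.
  have Ab t : `|u t| <= Mbound.
    by apply: below_orthant_norm (attractor_below (Au t)); exact: full_orthant su.
  have [_] := phi_lipschitz r0 (full_orthant (t0 - r) su) (full_orthant (s - r) su)
    (Ab _) (Ab _).
  rewrite !phi_full // !subrK => /le_lt_trans; apply.
  by rewrite -/L mulrC -ltr_pdivlMr.
have /andP[lo hi] := Hd _ key.
have h1 : s - r < t0 - r + e.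
  rewrite ltNge; apply/negP => h; move: lo; apply/negP; rewrite -leNgt.
  by apply: potential_antitone ou ux h _; left; exact: ltW (HT _ rT).
have h2 : t0 - r - e < s - r.
  rewrite ltNge; apply/negP => h; move: hi; apply/negP; rewrite -leNgt.
  apply: potential_antitone ou ux h _; right; apply: ltW (HT _ _); lra.
rewrite ltr_norml; lra.
Unshelve. all: by end_near. Qed.

(** At a zero of the vector field the orbit would be constant, hence not injective. *)
Lemma orbit_vfield_neq0 t : vfield (u t) != 0.
Proof.
apply/eqP => f0; have [su _] := ou.
have E : (fun s => u (s + t)) = (fun=> u t).
  apply: full_unique; [exact: full_shift| |by rewrite add0r].
  by apply: equilibrium_solution => //; exact: full_orthant su.
have /(congr1 (fun f => f 1)) /= := E => /(emanates_inj ou eu ux).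
lra.
Qed.

(** The orbit itself is the parametrization and the clock its inverse; relative
openness of the set of points with clock in a given interval supplies U. *)
Lemma orbit_one_dimensional : one_dimensional unstable_branch.
Proof.
split; first by exists (u 0); rewrite unstable_branch_range; exists 0.
move=> p; rewrite {1}unstable_branch_range => -[t0 _ <-].
have [U oU UE] : exists2 U, open U & U `&` unstable_branch = clock @^-1` `]t0 - 1,
  t0 + 1[ `&` unstable_branch.
  apply/open_subspaceP; have /continuousP := clock_continuous; apply.
  exact: interval_open.
have gE (s : R) : is_derive s (1 : R) (fun s => u (s + t0)) (vfield (u (s + t0))).
  by have [su _] := ou; exact: full_derive (full_shift t0 su).
have dE : (fun s : R => u (s + t0))^`()%classic = fun s => vfield (u (s + t0)).
  by apply/funext => s; rewrite derive1E; have [_ ->] := gE s.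
exists U, (fun s => u (s + t0)), (fun q => clock q - t0); split => //.
- have : (clock @^-1` `]t0 - 1, t0 + 1[ `&` unstable_branch) (u t0).
    by split; [rewrite /= clockK in_itv /=; lra|rewrite unstable_branch_range;
      exists t0].
  by rewrite -UE => -[].
- rewrite setIC UE; apply/seteqP; split => [_ [s + <-]|q []].
    rewrite /= !in_itv /= clockK => /andP[s1 s2]; split; first by lra.
    by rewrite unstable_branch_range; exists (s + t0).
  rewrite /= in_itv /= unstable_branch_range => /[swap] -[s _ <-];
    rewrite clockK => /andP[s1 s2].
  exists (s - t0); last by rewrite subrK.
  by rewrite /= in_itv /=; lra.
- apply: (continuous_subspaceW (B := unstable_branch)); first by move=> q [].
  by move=> q; apply: cvgB; [exact: clock_continuous|exact: cvg_cst].
- move=> s _; split.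
  + by rewrite clockK addrK.
  + by have [] := gE s.
  + rewrite dE; apply: (@continuous_comp _ _ _ (fun s => u (s + t0)) vfield).
      by have [su _] := ou; apply: full_continuous; exact: full_shift.
    exact: vfield_continuous.
  + by rewrite dE; exact: orbit_vfield_neq0.
Qed.

End Orbit.

Lemma unstable_branch_one_dimensional : one_dimensional unstable_branch.
Proof.
have [_ /unstable_branchP [u [ou eu <- x0]]] := unstable_branch_nonempty.
exact: orbit_one_dimensional ou eu x0.
Qed.

End Flow.

End System.

Unset Implicit Arguments.

Theorem theorem1p4 (R : realType) (k k3 k5 : R)
    (hk : 0 < k) (hk3 : 0 < k3) (hk5 : 0 < k5) :
  uniformly_persistent k k3 k5 /\
  forall (phi : R -> R3 R -> R3 R), solution_semiflow k k3 k5 phi ->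
  forall (A : set (R3 R)), compact_attractor phi A ->
  exists C A1 : set (R3 R),
    [/\ [/\ A = [set (0 : R3 R)] `|` C `|` A1,
            [disjoint [set (0 : R3 R)] & C],
            [disjoint [set (0 : R3 R)] & A1] &
            [disjoint C & A1]],
        forall B : set (R3 R), B `<=` faceS -> bounded_set B ->
          attracts phi [set (0 : R3 R)] B,
        [/\ compact A1, flow_invariant phi A1, A1 `<=` orthant° &
            forall B : set (R3 R), compact B -> B `<=` orthant ->
              [disjoint B & faceS] -> attracts phi A1 B] &
        [/\ C = unstable_manifold0 k k3 k5 `\` [set (0 : R3 R)],
            one_dimensional C &
            connects0 k k3 k5 C A1]].
Proof.
split; first exact: uniform_persistence.
move=> phi Hphi A HA.
exists (@unstable_branch R k k3 k5), (@interior_attractor R k k3 k5 phi A).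
split.
- split.
  + exact: attractor_decomposition.
  + exact: zero_unstable_branch_disjoint.
  + exact: zero_interior_attractor_disjoint.
  + exact: unstable_branch_interior_attractor_disjoint.
- by move=> B; exact: (face_attracted hk hk3 hk5 Hphi).
- split.
  + exact: interior_attractor_compact.
  + exact: interior_attractor_invariant.
  + exact: interior_attractor_interior.
  + by move=> B; exact: (interior_attractor_attracts hk hk3 hk5 Hphi HA).
- split=> //.
  + exact: unstable_branch_one_dimensional HA.
  + exact: unstable_branch_connects.
Qed.
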